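(* Let $X$ be a compact Ptolemy space with the following two properties: (E) there is at least one Ptolemy circle in $X$; (I) for each pair of distinct points $\omega,\omega'\in X$ and every sphere $S\subset X$ between $\omega,\omega'$ there is a unique space inversion $\varphi_{\omega,\omega',S}:X\to X$ with respect to $\omega,\omega'$ and $S$. Then any Möbius map $\sigma\to\sigma'$ between any Ptolemy circles $\sigma,\sigma'\subset X$ extends to a Möbius automorphism of $X$.
   Context: Metrics may be extended: a metric $d$ on $X$ may have at most one infinitely remote point $\omega\in X$, with $d(x,\omega)=\infty$ for $x\ne\omega$ and $d(\omega,\omega)=0$. A quadruple $(x,y,z,u)$ is admissible if no entry occurs three or four times. Its cross-ratio triple is $\mathrm{crt}_d(x,y,z,u)=(d(x,y)d(z,u):d(x,z)d(y,u):d(x,u)d(y,z))\in\mathbb{R}P^2$, with infinite factors cancelled: $\mathrm{crt}_d(x,y,z,\infty)=(d(x,y):d(x,z):d(y,z))$, $\mathrm{crt}_d(x,y,\infty,\infty)=(0:1:1)$. Two metrics are Möbius equivalent if they have the same cross-ratio triples on admissible quadruples. A Möbius structure on $X$ is a class of pairwise Möbius equivalent metrics (the full equivalence class); a set with a Möbius structure is a Möbius space. Its topology has as basis the open balls around non-remote points and the complements of closed balls, for any metric of the structure. A map is Möbius if it is injective and preserves cross-ratio triples of admissible quadruples (subsets carry the induced Möbius structure); a Möbius automorphism is a bijective Möbius map $X\to X$. A Ptolemy space is a Möbius space such that for every admissible $Q$ the entries of $\mathrm{crt}(Q)$ satisfy the triangle inequality. A Ptolemy circle is a subset $\sigma\subset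 X$ homeomorphic to $S^1$ such that $d(x,z)d(y,u)=d(x,y)d(z,u)+d(x,u)d(y,z)$ for all distinct $x,y,z,u\in\sigma$ such that $(x,z)$ separates $(y,u)$ on $\sigma$. For distinct $\omega,\omega'$, a sphere between $\omega,\omega'$ is an equivalence class in $X\setminus\{\omega,\omega'\}$ of the relation $x\sim y\iff\mathrm{crt}(\omega,x,y,\omega')=(1:1:\ast)$. A space inversion with respect to $\omega,\omega',S$, where $S$ is a sphere between $\omega,\omega'$, is a Möbius involution $\varphi:X\to X$, $\varphi^2=\mathrm{id}$, without fixed points, such that $\varphi(\omega)=\omega'$, $\varphi(S)=S$, and $\varphi(\sigma)=\sigma$ for every Ptolemy circle $\sigma$ through $\omega,\omega'$. *)

(* Defs.v *)
From HB Require Import structures.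
From mathcomp Require Import all_boot all_order all_algebra.
From mathcomp Require Import all_classical all_reals all_analysis.

Set Implicit Arguments.
Unset Strict Implicit.
Unset Printing Implicit Defensive.

Import Order.TTheory GRing.Theory Num.Theory.
Import numFieldNormedType.Exports.

Local Open Scope classical_set_scope.
Local Open Scope ring_scope.

(* The remote point is part of the data: on a two-point space with distance
   +oo the distance function alone does not tell which point is remote. *)
Record xmetric (R : realType) (X : Type) := XMetric {
  xdist :> X -> X -> \bar R;
  remote : option X;
  xdist_ge0 : forall x y, (0 <= xdist x y)%E;
  xdist_eq0 : forall x y, xdist x y = 0%E <-> x = y;
  xdistC : forall x y, xdist x y = xdist y x;
  xdist_triangle : forall x y z, (xdist x z <= xdist x y + xdist y z)%E;
  xdist_pinfty : forall x y, xdist x y = +oo%E <->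
    x <> y /\ (remote = Some x \/ remote = Some y) }.

Definition admissible (X : Type) (x y z u : X) : Prop :=
  [/\ ~ (x = y /\ y = z), ~ (x = y /\ y = u),
      ~ (x = z /\ z = u) & ~ (y = z /\ z = u)].

(* In the cross-ratio triple of an admissible quadruple, either no factor is
   infinite, or each of the three products contains exactly one factor +oo
   (remote point occurring once), or the remote point w occurs twice and the
   triple is (0 : oo * oo : oo * oo) up to order, with 0 = d(w,w) d(x,y).
   Hence cancelling infinite factors amounts to replacing each of them by 1. *)
Definition cancel_oo (R : realType) (e : \bar R) : R :=
  if e is r%:E then r else 1.

(* Homogeneous coordinates; equality in the projective plane is [proj_eq]. *)
Definition crt_of (R : realType) (X : Type) (d : xmetric R X) (x y z u : X) :
    R * R * R :=
  (cancel_oo (d x y) * cancel_oo (d z u),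
   cancel_oo (d x z) * cancel_oo (d y u),
   cancel_oo (d x u) * cancel_oo (d y z)).

Definition proj_eq (R : realType) (p q : R * R * R) : Prop :=
  let: (a, b, c) := p in let: (a', b', c') := q in
  exists2 k : R, k != 0 & [/\ a' = k * a, b' = k * b & c' = k * c].

Definition mobius_equiv (R : realType) (X : Type) (d d' : xmetric R X) : Prop :=
  forall x y z u, admissible x y z u ->
    proj_eq (crt_of d x y z u) (crt_of d' x y z u).

Record mobiusSpace (R : realType) := MobiusSpace {
  mobius_sort :> Type;
  mobius_metrics : set (xmetric R mobius_sort);
  mobius_class : exists d, mobius_metrics = [set d' | mobius_equiv d d'] }.

Arguments mobius_metrics {R} _.
Arguments mobius_class {R} _.

Section MobiusTheory.
Context {R : realType}.
Implicit Type X : mobiusSpace R.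

Lemma proj_eq_refl (p : R * R * R) : proj_eq p p.
Proof. by case: p => [[a b] c]; exists 1; rewrite ?oner_neq0 ?mul1r. Qed.

Lemma proj_eq_sym (p q : R * R * R) : proj_eq p q -> proj_eq q p.
Proof.
case: p q => [[a b] c] [[a' b'] c'] [k k0 [-> -> ->]].
by exists k^-1; rewrite ?invr_eq0 ?mulKf.
Qed.

Lemma proj_eq_trans (p q r : R * R * R) :
  proj_eq p q -> proj_eq q r -> proj_eq p r.
Proof.
case: p q r => [[a b] c] [[a' b'] c'] [[a2 b2] c2].
move=> [k k0 [-> -> ->]] [l l0 [-> -> ->]].
by exists (l * k); rewrite ?mulf_neq0 ?mulrA.
Qed.

Lemma mobius_metrics_neq0 X : exists d, mobius_metrics X d.
Proof.
have [d ->] := mobius_class X; exists d => x y z u _; exact: proj_eq_refl.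
Qed.

(* A chosen metric of the structure.  The notions below do not depend on the
   choice: see [crtE] for cross-ratio triples; Moebius equivalent metrics also
   induce the same topology. *)
Definition mobius_metric X : xmetric R X :=
  projT1 (cid (mobius_metrics_neq0 X)).

Lemma mobius_metricP X : mobius_metrics X (mobius_metric X).
Proof. exact: projT2 (cid (mobius_metrics_neq0 X)). Qed.

Definition crt X (x y z u : X) : R * R * R := crt_of (mobius_metric X) x y z u.

Lemma crtE X (d : xmetric R X) (x y z u : X) : mobius_metrics X d ->
  admissible x y z u -> proj_eq (crt x y z u) (crt_of d x y z u).
Proof.
move: (mobius_metricP X); rewrite /crt; have [d0 ->] := mobius_class X.
move=> d0m d0d adm.
exact: proj_eq_trans (proj_eq_sym (d0m _ _ _ _ adm)) (d0d _ _ _ _ adm).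
Qed.

(* Open balls and complements of closed balls around non-remote points.  They
   form a basis unless X is a single remote point, in which case there are
   none; generating from them as a subbase covers this case too. *)
Definition mobius_basis X : set (set X) :=
  [set U | exists (x : X) (r : R),
     [/\ remote (mobius_metric X) <> Some x, 0 < r &
         U = [set y | (mobius_metric X x y < r%:E)%E] \/
         U = ~` [set y | (mobius_metric X x y <= r%:E)%E]]].

End MobiusTheory.

HB.instance Definition _ (R : realType) (X : mobiusSpace R) :=
  gen_eqMixin (mobius_sort X).
HB.instance Definition _ (R : realType) (X : mobiusSpace R) :=
  gen_choiceMixin (mobius_sort X).
HB.instance Definition _ (R : realType) (X : mobiusSpace R) :=
  @isSubBaseTopological.Build (mobius_sort X) (set (mobius_sort X))
    (@mobius_basis R X) id.

Definition homeomorphic_sets (T U : topologicalType) (A : set T) (B : set U) :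
    Prop :=
  exists (f : T -> U) (g : U -> T),
    [/\ set_fun A B f, set_fun B A g, {in A, cancel f g}, {in B, cancel g f} &
        {within A, continuous f} /\ {within B, continuous g}].

Definition unit_circle (R : realType) : set (R * R) :=
  [set p | p.1 ^+ 2 + p.2 ^+ 2 = 1].

Section Ptolemy.
Context {R : realType} (X : mobiusSpace R).

(* [f] restricted to [A] is a Moebius map for the induced structure on [A]. *)
Definition mobius_on (A : set X) (f : X -> X) : Prop :=
  set_inj A f /\
  forall x y z u, A x -> A y -> A z -> A u -> admissible x y z u ->
    proj_eq (crt (f x) (f y) (f z) (f u)) (crt x y z u).

Definition mobius_automorphism (f : X -> X) : Prop :=
  bijective f /\ mobius_on [set: X] f.

Definition ptolemy_space : Prop :=
  forall x y z u : X, admissible x y z u ->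
    let: (a, b, c) := crt x y z u in
    [/\ a <= b + c, b <= a + c & c <= a + b].

Definition separates (A : set X) (x z y u : X) : Prop :=
  ~ connected_component (A `\` [set x; z]) y u.

(* The Ptolemy equality is homogeneous in the cross-ratio triple; using the
   latter gives it its meaning when one of the points is remote. *)
Definition ptolemy_circle (A : set X) : Prop :=
  homeomorphic_sets A (@unit_circle R) /\
  forall x y z u, A x -> A y -> A z -> A u ->
    x <> y -> x <> z -> x <> u -> y <> z -> y <> u -> z <> u ->
    separates A x z y u ->
    let: (a, b, c) := crt x y z u in b = a + c.

Definition sphere_rel (w w' x y : X) : Prop :=
  exists t : R, proj_eq (crt w x y w') (1, 1, t).

Definition sphere_between (w w' : X) (S : set X) : Prop :=
  exists x, [/\ x <> w, x <> w' &
    S = [set y | [/\ y <> w, y <> w' & sphere_rel w w' x y]]].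

Definition space_inversion (w w' : X) (S : set X) (phi : X -> X) : Prop :=
  [/\ mobius_automorphism phi /\ involutive phi,
      forall x, phi x <> x,
      phi w = w',
      phi @` S = S &
      forall A, ptolemy_circle A -> A w -> A w' -> phi @` A = A].

End Ptolemy.

(* Main.v *)
Require Import Defs.
From mathcomp Require Import all_boot all_order all_algebra.
From mathcomp Require Import all_classical all_reals all_analysis.
From mathcomp Require Import ring lra.

(* Fix a point [w] of a circle; with [w] remote the metric lives on the
   complement [M] of [w], the circles through [w] are the isometric images of
   the real line, and inversions centred at [o] act on lines through [o] by
   [t |-> - r^2 / t]. Composing inversions gives homotheties, and limits of
   products of homotheties show that the isometries of [M] are transitive, so
   it is enough to map a line [c] through [o] onto any other line [c'] through
   [o] by an isometry fixing [o].

   Let [b] be the Busemann function of [c']. Replace [c] by the image under an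
   isometry fixing [o] that maximises the slope [a] of [b] along [c]. Translate
   [c] by [1] along [c'] and invert at [o]: the result is a circle arc from
   [c' (- 1)] to [o]. Blowing up at any of its points shows that the slope of
   [b] along the arc is nowhere larger than [a], while [b] increases by [1]; if
   [a < 1], the arc is too short for this, since the distance from [o] to
   the translate of [c x] is at least [1 + a x]. Hence [a = 1], which forces
   [c = c']. The argument breaks down when [c] is [c'] reversed: then one
   passes through a third line, or [M] is a single line, or [b] would be
   strictly decreasing along a closed circle. *)

Import Order.TTheory GRing.Theory Num.Theory.
Import numFieldNormedType.Exports.
Set Implicit Arguments.
Unset Strict Implicit.
Unset Printing Implicit Defensive.
Local Open Scope classical_set_scope.
Local Open Scope ring_scope.

(** * Limits along a free ultrafilter *)

Section FreeUltrafilter.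

(** The obstacle is that maximality controls the slope of [b] only along curves issuing from [o],
    whereas the arc passes through other points. Ptolemy's inequality removes it: lines at sublinear
    distance have the same Busemann function up to a constant, so a dilation about any centre
    multiplies differences of [b] by its factor, and comparing dilations at two centres gives
    isometries that move any point to [o] and preserve differences of [b]. Uniqueness in (I) enters
    through conjugation: an isometry carries the inversion at [o] to the one at its image, so an
    isometry fixing [o] commutes with the dilations about [o]. All limits are taken along one free
    ultrafilter, so that a sequence of maps has a limit at all points at once, without diagonal
    subsequences. The blow-up then bounds difference quotients only for some arbitrarily small
    steps, which is enough for monotonicity. A Moebius map of a circle that fixes [w] is a
    similarity between lines of [M]; a map [f] with [f w <> w] is first composed with an inversion
    exchanging [w] and [f w]. *)

Lemma free_ultrafilter_exists :
  exists F : set_system nat, UltraFilter F /\ \oo `<=` F.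
Proof. by have [G [GU sub]] := @ultraFilterLemma nat \oo _; exists G. Qed.

Definition free_ultrafilter : set_system nat :=
  projT1 (cid free_ultrafilter_exists).

Lemma free_ultrafilter_ultra : UltraFilter free_ultrafilter.
Proof. by rewrite /free_ultrafilter; case: cid => ? []. Qed.

Lemma free_ultrafilter_oo : \oo `<=` free_ultrafilter.
Proof. by rewrite /free_ultrafilter; case: cid => ? []. Qed.

End FreeUltrafilter.

#[global] Instance free_ultrafilter_instance : UltraFilter free_ultrafilter :=
  free_ultrafilter_ultra.
#[global] Instance free_ultrafilter_proper : ProperFilter free_ultrafilter :=
  @ultra_proper _ _ free_ultrafilter_ultra.

Local Notation "'\U'" := free_ultrafilter.

Section UltraLimits.
Context {R : realType}.
Implicit Types u v : nat -> R.

Lemma ultra_cvg_oo u (l : R) : u @ \oo --> l -> u @ \U --> l.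
Proof. by move=> ul A /ul; apply: free_ultrafilter_oo. Qed.

Lemma ultra_ext u v (l : R) : u =1 v -> v @ \U --> l -> u @ \U --> l.
Proof. by move=> /funext ->. Qed.

Lemma ultra_ext_near u v (l : R) : (\forall n \near \U, u n = v n) ->
  v @ \U --> l -> u @ \U --> l.
Proof.
move=> uv vl; apply: cvg_trans vl; apply: near_eq_cvg.
by apply: filterS uv => n ->.
Qed.

Lemma ultra_cvg_unique u (a b : R) : u @ \U --> a -> u @ \U --> b -> a = b.
Proof. exact: cvg_unique. Qed.

Lemma ultra_le u v (a b : R) : (forall n, u n <= v n) ->
  u @ \U --> a -> v @ \U --> b -> a <= b.
Proof. by move=> uv ua vb; apply: (ler_cvg_to ua vb); near=> n.
Unshelve. all: by end_near. Qed.

Lemma ultra_near u (a : nat -> R) (l : R) : (forall n, `|u n - l| <= a n) ->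
  a @ \U --> (0 : R) -> u @ \U --> l.
Proof.
move=> ua /cvgrPdist_le a0; apply/cvgrPdist_le => e /a0; apply: filterS => n.
by rewrite sub0r normrN distrC => /(le_trans (ler_norm _)); exact: le_trans.
Qed.

Lemma ultra_squeeze u v : (forall n, 0 <= u n <= v n) ->
  v @ \U --> (0 : R) -> u @ \U --> (0 : R).
Proof.
move=> uv; apply: ultra_near => n; rewrite subr0; have /andP[u0 uvn] := uv n.
by rewrite ger0_norm.
Qed.

Lemma ultra_add0 u v : u @ \U --> (0 : R) -> v @ \U --> (0 : R) ->
  (fun n => u n + v n) @ \U --> (0 : R).
Proof. by move=> u0 v0; rewrite -[X in _ --> X]addr0; exact: cvgD. Qed.

Lemma ultra_mul0 u (a : R) : u @ \U --> (0 : R) ->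
  (fun n => u n * a) @ \U --> (0 : R).
Proof. by move=> u0; rewrite -[X in _ --> X](mul0r a); apply: cvgM u0 (cvg_cst a). Qed.

Lemma cvg_expV4 : (fun n : nat => (4 : R) ^- n) @ \U --> (0 : R).
Proof.
apply: ultra_cvg_oo; under eq_fun do rewrite -exprVn.
by apply: cvg_expr; rewrite ger0_norm ?invr_ge0// invf_lt1// ltr1n.
Qed.

End UltraLimits.

(** * Inversive spaces, similarities and their limits *)

Definition isometric_line (R : realType) (M : Type) (d : M -> M -> R)
    (c : R -> M) : Prop :=
  forall s t, d (c s) (c t) = `|s - t|.

(* A space inversion exchanging [o] with the point at infinity, read in the
   complement of the latter; the junk value [w o = o] makes [w] an involution.
   In [inv_line], [r ^+ 2 / 0 = 0] is the matching junk value. *)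
Record inversion (R : realType) (M : Type) (d : M -> M -> R) (o : M) (r : R)
    (w : M -> M) : Prop := Inversion {
  invK : involutive w;
  inv_center : w o = o;
  inv_neq : forall x, x <> o -> w x <> x;
  inv_distc : forall x, x <> o -> d (w x) o = r ^+ 2 / d x o;
  inv_dist : forall x y, x <> o -> y <> o ->
    d (w x) (w y) = r ^+ 2 * d x y / (d x o * d y o);
  inv_line : forall c, isometric_line d c -> c 0 = o ->
    forall t, w (c t) = c (- (r ^+ 2 / t)) }.

(** These are the properties of the complement of a point of [X]. [dist_proper] expresses
    compactness of [X], with a limit along the fixed ultrafilter in place of a subsequence. The
    inversion axioms ask for a nonempty sphere because (I) speaks of equivalence classes. *)
Record inversiveSpace (R : realType) := InversiveSpace {
  point :> Type;
  dist : point -> point -> R;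
  dist_eq0 : forall x y, dist x y = 0 <-> x = y;
  distC : forall x y, dist x y = dist y x;
  dist_triangle : forall x y z, dist x z <= dist x y + dist y z;
  dist_ptolemy : forall x y z u,
    dist x z * dist y u <= dist x y * dist z u + dist x u * dist y z;
  dist_proper : forall (u : nat -> point) (o : point) (B : R),
    (forall n, dist (u n) o <= B) ->
    exists x, (fun n => dist (u n) x) @ \U --> (0 : R);
  dist_line : exists c, isometric_line dist c;
  inversion_ex : forall o r, 0 < r -> (exists x, dist x o = r) ->
    exists w, inversion dist o r w;
  inversion_uniq : forall o r w w', 0 < r -> (exists x, dist x o = r) ->
    inversion dist o r w -> inversion dist o r w' -> w =1 w' }.

Section Metric.
Context {R : realType} {M : inversiveSpace R}.
Implicit Types (x y z o : M) (u v : nat -> M).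
Local Notation d := (@dist R M).
Local Notation line := (isometric_line d).

Lemma distxx x : d x x = 0. Proof. exact/dist_eq0. Qed.

Lemma dist_ge0 x y : 0 <= d x y.
Proof.
by have := dist_triangle x y x; rewrite distxx (distC y) -mulr2n pmulrn_lge0.
Qed.

Lemma dist_gt0 x y : x <> y -> 0 < d x y.
Proof.
by move=> xy; rewrite lt_neqAle dist_ge0 andbT eq_sym; apply/eqP => /dist_eq0.
Qed.

Lemma dist_neq0 x y : x <> y -> d x y != 0.
Proof. by move=> xy; rewrite gt_eqF// dist_gt0. Qed.

Lemma dist_neq x y : 0 < d x y -> x <> y.
Proof. by move=> + xy; rewrite xy distxx ltxx. Qed.

Lemma dist_sub x y z : `|d x z - d y z| <= d x y.
Proof.
rewrite ler_norml; have := dist_triangle x y z; have := dist_triangle y x z.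
rewrite (distC y x); lra.
Qed.

Definition converges u x := (fun n => d (u n) x) @ \U --> (0 : R).

Lemma converges_cst x : converges (fun=> x) x.
Proof. by rewrite /converges distxx; exact: cvg_cst. Qed.

Lemma converges_squeeze u x (a : nat -> R) : (forall n, d (u n) x <= a n) ->
  a @ \U --> (0 : R) -> converges u x.
Proof. by move=> ua; apply: ultra_squeeze => n; rewrite dist_ge0 ua. Qed.

Lemma dist_cvg u v x y : converges u x -> converges v y ->
  (fun n => d (u n) (v n)) @ \U --> d x y.
Proof.
move=> ux vy; apply: ultra_near (ultra_add0 ux vy) => n /=.
have := dist_sub (u n) x (v n); have := dist_sub (v n) y x.
rewrite [d (v n) x]distC [d y x]distC !ler_norml /=; lra.
Qed.

Lemma converges_unique u x y : converges u x -> converges u y -> x = y.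
Proof.
move=> ux uy; apply/dist_eq0; have := dist_cvg ux uy.
under eq_fun do rewrite distxx.
by move/ultra_cvg_unique; apply; exact: cvg_cst.
Qed.

Lemma converges_dist u v x : (fun n => d (u n) (v n)) @ \U --> (0 : R) ->
  converges v x -> converges u x.
Proof.
move=> uv vx; apply: (@converges_squeeze _ _ (fun n => d (u n) (v n) + d (v n) x)).
  by move=> n; exact: dist_triangle.
exact: ultra_add0.
Qed.

(** The inverse is carried along because limits of such maps are shown to be bijective by passing to
    the limit in the inverses as well. *)
Record similarity (k : R) (g h : M -> M) : Prop := Similarity {
  sim_gt0 : 0 < k;
  simK : cancel g h;
  simVK : cancel h g;
  sim_dist : forall x y, d (g x) (g y) = k * d x y }.

Lemma similarity_inv k g h : similarity k g h -> similarity k^-1 h g.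
Proof.
case=> k0 gK hK gd; split => //; first by rewrite invr_gt0.
by move=> x y; rewrite -{2}(hK x) -{2}(hK y) gd mulKf ?gt_eqF.
Qed.

Lemma similarity_comp k g h k' g' h' : similarity k g h ->
  similarity k' g' h' -> similarity (k * k') (g \o g') (h' \o h).
Proof.
case=> k0 gK hK gd [k0' gK' hK' gd']; split; first exact: mulr_gt0.
- exact: can_comp.
- exact: can_comp.
- by move=> x y /=; rewrite gd gd' mulrA.
Qed.

Lemma similarity_id : similarity 1 id id.
Proof. by split => // x y; rewrite mul1r. Qed.

Lemma similarity_iter k g h n : similarity k g h ->
  similarity (k ^+ n) (iter n g) (iter n h).
Proof.
move=> gh; elim: n => [|n IHn]; first exact: similarity_id.
have := similarity_comp gh IHn; rewrite -exprS; case=> k0 gK hK gd; split => // x.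
- by rewrite (iterSr n h); exact: gK.
- by rewrite (iterSr n h); exact: hK.
Qed.

Lemma similarity_inj k g h x y : similarity k g h -> g x = g y -> x = y.
Proof. by move=> /simK gK /(congr1 h); rewrite !gK. Qed.

Definition isometry g h := similarity 1 g h.

Lemma isometry_dist g h x y : isometry g h -> d (g x) (g y) = d x y.
Proof. by move=> /sim_dist ->; rewrite mul1r. Qed.

Lemma isometry_inv g h : isometry g h -> isometry h g.
Proof. by move=> /similarity_inv; rewrite invr1. Qed.

Lemma isometry_comp g h g' h' : isometry g h -> isometry g' h' ->
  isometry (g \o g') (h' \o h).
Proof. by move=> gh gh'; have := similarity_comp gh gh'; rewrite mulr1. Qed.

Lemma isometry_line g h c : isometry g h -> line c -> line (g \o c).
Proof. by move=> gh cl s t /=; rewrite (isometry_dist _ _ gh). Qed.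

Lemma line_shift c a : line c -> line (fun t => c (a + t)).
Proof. by move=> cl s t; rewrite cl; congr `|_|; ring. Qed.

Lemma line_opp c : line c -> line (fun t => c (- t)).
Proof. by move=> cl s t; rewrite cl distrC; congr `|_|; ring. Qed.

Lemma line_scale k g h c : similarity k g h -> line c ->
  line (fun t => g (c (t / k))).
Proof.
move=> gh cl s t; have k0 := sim_gt0 gh; rewrite (sim_dist gh) cl.
by rewrite -mulrBl normrM [`|k^-1|]gtr0_norm ?invr_gt0// mulrC divfK ?gt_eqF.
Qed.

Lemma line_dist0 c o t : line c -> c 0 = o -> d (c t) o = `|t|.
Proof. by move=> cl <-; rewrite cl subr0. Qed.

Lemma line_inj c s t : line c -> c s = c t -> s = t.
Proof.
by move=> cl st; apply/eqP; rewrite -subr_eq0 -normr_eq0 -cl st distxx.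
Qed.

(* Arzela-Ascoli: the hypothesis is a form of locally uniform convergence of
   the distances, for maps that are similarities only in the limit. *)
Definition asymptotic (k : R) (g : nat -> M -> M) := forall u v x y,
  converges u x -> converges v y ->
  (fun n => d (g n (u n)) (g n (v n))) @ \U --> k * d x y.

Lemma asymptotic_isometry g h : (forall n, isometry (g n) (h n)) ->
  asymptotic 1 g.
Proof.
move=> gh u v x y ux vy; rewrite mul1r.
under eq_fun do rewrite (isometry_dist _ _ (gh _)); exact: dist_cvg.
Qed.

Lemma asymptotic_proper k g o B : asymptotic k g ->
  (forall n, d (g n o) o <= B) -> forall x, exists y, converges (g^~ x) y.
Proof.
move=> ag gB x.
have gx := ag _ _ _ _ (converges_cst x) (converges_cst o).
pose a := k * d x o + 1.
(* [dist_proper] wants a bound for all [n], but [d (g n x) (g n o) <= a] is only known for almost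
   all [n] in the sense of the ultrafilter; elsewhere the value is replaced by [o]. *)
pose u n := if d (g n x) (g n o) <= a then g n x else o.
have [|y uy] := @dist_proper _ M u o (`|a| + B).
  have B0 : 0 <= B by exact: le_trans (dist_ge0 _ _) (gB 0%N).
  move=> n; rewrite /u; case: ifPn => h; last by rewrite distxx addr_ge0.
  rewrite (le_trans (dist_triangle _ (g n o) _))// lerD//.
  exact: le_trans h (ler_norm _).
exists y; apply: cvg_trans uy; apply: near_eq_cvg.
have la : k * d x o < a by rewrite ltrDl.
near=> n; rewrite /u ifT//.
by apply: ltW; near: n; exact: (cvgr_lt _ gx).
Unshelve. all: by end_near. Qed.

Lemma asymptotic_limit k g h o B : 0 < k ->
  (forall n, cancel (g n) (h n)) -> (forall n, cancel (h n) (g n)) ->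
  asymptotic k g -> asymptotic k^-1 h ->
  (forall n, d (g n o) o <= B) -> (forall n, d (h n o) o <= B) ->
  exists g' h', [/\ similarity k g' h',
    forall x, converges (g^~ x) (g' x) & forall x, converges (h^~ x) (h' x)].
Proof.
move=> k0 gK hK ag ah gB hB.
have [g' gg'] := choice (asymptotic_proper ag gB).
have [h' hh'] := choice (asymptotic_proper ah hB).
have sd (a : R) f f' : asymptotic a f -> (forall x, converges (f^~ x) (f' x)) ->
    forall x y, d (f' x) (f' y) = a * d x y.
  move=> af ff' x y; apply: ultra_cvg_unique (dist_cvg (ff' x) (ff' y)) _.
  exact: af (converges_cst x) (converges_cst y).
(* Since [f1 n x] tends to [f1' x], the points [f n (f1' x)] and [f n (f1 n x) = x] come
   together. *)
have canc (a : R) f f1 f' f1' : (forall n, cancel (f1 n) (f n)) ->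
    asymptotic a f -> (forall x, converges (f^~ x) (f' x)) ->
    (forall x, converges (f1^~ x) (f1' x)) -> cancel f1' f'.
  move=> fK af ff' ff1' x; apply: (@converges_unique (fun n => f n (f1' x))) => //.
  have := af _ _ _ _ (converges_cst (f1' x)) (ff1' x).
  by rewrite distxx mulr0; under eq_fun do rewrite fK.
exists g', h'; split => //; split => //.
- exact: canc gK ah hh' gg'.
- exact: canc hK ag gg' hh'.
- exact: sd ag gg'.
Qed.

Lemma isometry_limit g h o B : (forall n, isometry (g n) (h n)) ->
  (forall n, d (g n o) o <= B) ->
  exists g' h', [/\ isometry g' h',
    forall x, converges (g^~ x) (g' x) & forall x, converges (h^~ x) (h' x)].
Proof.
move=> gh gB; apply: (@asymptotic_limit 1 _ _ o B) => //.
- by move=> n; exact: simK (gh n).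
- by move=> n; exact: simVK (gh n).
- exact: asymptotic_isometry gh.
- by rewrite invr1; apply: (@asymptotic_isometry _ g) => n; exact: isometry_inv.
- move=> n; have gn := gh n; rewrite -(isometry_dist _ _ gn) (simVK gn).
  by rewrite distC.
Qed.

End Metric.

(** * Homotheties and transitivity *)

Section Homotheties.
Context {R : realType} {M : inversiveSpace R}.
Implicit Types (x y z o : M) (u v : nat -> M).
Local Notation d := (@dist R M).
Local Notation line := (isometric_line d).

Lemma lipschitz1_continuous (f : R -> R) :
  (forall s t, `|f s - f t| <= `|s - t|) -> continuous f.
Proof.
move=> fl s; apply/cvgrPdist_le => e e0; near=> t.
rewrite (le_trans (fl _ _))//; near: t; exact: (@cvgr_dist_le _ _ _ _ _ id s).
Unshelve. all: by end_near. Qed.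

(** Inversions are only available for nonempty spheres, and before transitivity no line through [x]
    is known; along any line the distance to [x] takes all large values. *)
Lemma large_sphere x : exists D : R, 0 < D /\
  forall r, D <= r -> exists y, d y x = r.
Proof.
have [c cl] := dist_line M.
exists (d (c 0) x + 1); split; first by have := dist_ge0 (c 0) x; lra.
move=> r Dr; pose f t := d (c t) x.
have fc : continuous f.
  by apply: lipschitz1_continuous => s t; rewrite -(cl s t); exact: dist_sub.
pose b := r + d (c 0) x.
have b0 : 0 <= b by rewrite /b; have := dist_ge0 (c 0) x; lra.
have fb : r <= f b.
  have := dist_triangle (c 0) x (c b); rewrite cl sub0r normrN ger0_norm//.
  by rewrite /f (distC x) /b; lra.
have [|t _ ft] := @IVT R f 0 b r b0 (continuous_subspaceT fc); last by exists (c t).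
have f0 : f 0 <= r by rewrite /f; lra.
by rewrite ge_min le_max f0 fb orbT.
Qed.

Record homothety o (k : R) (g h : M -> M) : Prop := Homothety {
  hom_sim : similarity k g h;
  hom_center : g o = o;
  hom_line : forall c, line c -> c 0 = o -> forall t, g (c t) = c (k * t) }.

Lemma homothety_inv o k g h : homothety o k g h -> homothety o k^-1 h g.
Proof.
case=> gh go gl; split; first exact: similarity_inv.
- by rewrite -{1}go (simK gh).
- move=> c cl c0 t; have k0 := lt0r_neq0 (sim_gt0 gh).
  by rewrite -[t in LHS](mulVKf k0) -gl// (simK gh).
Qed.

Lemma homothety_iter o k g h n : homothety o k g h ->
  homothety o (k ^+ n) (iter n g) (iter n h).
Proof.
case=> gh go gl; split; first exact: similarity_iter.
- by elim: n => //= n ->.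
- move=> c cl c0; elim: n => [|n IHn] t; first by rewrite mul1r.
  by rewrite iterS IHn gl// exprS mulrA.
Qed.

Lemma inv_neq_center o r w x : inversion d o r w -> x <> o -> w x <> o.
Proof.
by move=> iw + wx; apply; rewrite -(invK iw x) wx (inv_center iw).
Qed.

(** The conformal factors of [w] and [w'] cancel up to a constant, and on a line through [o] the
    maps [t |-> - r^2 / t] and [t |-> - r'^2 / t] compose to a multiplication. *)
Lemma inversion_homothety o r r' w w' : 0 < r -> 0 < r' ->
  inversion d o r w -> inversion d o r' w' ->
  homothety o (r ^+ 2 / r' ^+ 2) (w \o w') (w' \o w).
Proof.
move=> r0 r0' iw iw'.
have rn0 : r != 0 by rewrite gt_eqF.
have rn0' : r' != 0 by rewrite gt_eqF.
have hc : (w \o w') o = o by rewrite /= (inv_center iw') (inv_center iw).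
have ho x : d ((w \o w') x) o = r ^+ 2 / r' ^+ 2 * d x o.
  have [->|xo] := pselect (x = o); first by rewrite hc distxx mulr0.
  have xo0 := dist_neq0 xo.
  rewrite /= (inv_distc iw); last exact: inv_neq_center iw' xo.
  by rewrite (inv_distc iw')//; field; rewrite rn0' xo0.
split => //.
- split; first by rewrite divr_gt0 ?exprn_gt0.
  + by move=> x /=; rewrite (invK iw) (invK iw').
  + by move=> x /=; rewrite (invK iw') (invK iw).
  + move=> x y.
    have [->|xo] := pselect (x = o); first by rewrite hc distC ho (distC y).
    have [->|yo] := pselect (y = o); first by rewrite hc ho.
    have xo' := inv_neq_center iw' xo; have yo' := inv_neq_center iw' yo.
    have xo0 := dist_neq0 xo; have yo0 := dist_neq0 yo.
    rewrite /= (inv_dist iw)// (inv_dist iw')// !(inv_distc iw')//.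
    by field; rewrite rn0' xo0 yo0.
- move=> c cl c0 t /=; rewrite (inv_line iw')// (inv_line iw)//; congr c.
  have [->|t0] := eqVneq t 0; first by rewrite invr0 mulr0 oppr0 invr0 !mulr0 oppr0.
  by field; rewrite t0 rn0'.
Qed.

Lemma homothety_ex o k : 0 < k -> exists g h, homothety o k g h.
Proof.
move=> k0; have [D [D0 Dr]] := large_sphere o.
pose s := Num.sqrt k; have s0 : 0 < s by rewrite sqrtr_gt0.
(* Both [r' = D + D / s] and [r = s * D + D] are at least [D], so the two spheres are nonempty, and
   the ratio of the squares is [s ^+ 2 = k]. *)
pose r' := D + D / s; have r0' : 0 < r' by rewrite addr_gt0// divr_gt0.
pose r := s * r'; have r0 : 0 < r by rewrite mulr_gt0.
have [w' iw'] : exists w, inversion d o r' w.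
  by apply: inversion_ex => //; apply: Dr; rewrite lerDl ltW// divr_gt0.
have [w iw] : exists w, inversion d o r w.
  apply: inversion_ex => //; apply: Dr; rewrite /r /r' mulrDr mulrCA divff ?gt_eqF//.
  by rewrite mulr1 lerDr ltW// mulr_gt0.
exists (w \o w'), (w' \o w).
suff -> : k = r ^+ 2 / r' ^+ 2 by exact: inversion_homothety.
by rewrite /r exprMn mulfK ?expf_neq0 ?gt_eqF// sqr_sqrtr// ltW.
Qed.

(** Expanding by [4 ^+ n] about [x] fixes [x], and contracting by the same factor about [y] then
    brings it within [4 ^- n * d x y] of [y]; the composite is an isometry, and its limit sends [x]
    to [y]. *)
Lemma isometry_transitive x y : exists g h, isometry g h /\ g x = y.
Proof.
have k0 (n : nat) : (0 : R) < 4 ^+ n by rewrite exprn_gt0.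
have hx n : exists gh : (M -> M) * (M -> M), homothety x (4 ^+ n) gh.1 gh.2.
  by have [g [h gh]] := homothety_ex x (k0 n); exists (g, h).
have hy n : exists gh : (M -> M) * (M -> M), homothety y (4 ^+ n) gh.1 gh.2.
  by have [g [h gh]] := homothety_ex y (k0 n); exists (g, h).
have [fx {}hx] := choice hx; have [fy {}hy] := choice hy.
pose g n := (fy n).2 \o (fx n).1; pose h n := (fx n).2 \o (fy n).1.
have gh n : isometry (g n) (h n).
  have := similarity_comp (similarity_inv (hom_sim (hy n))) (hom_sim (hx n)).
  by rewrite mulVf// gt_eqF.
have gx n : d (g n x) y = 4 ^- n * d x y.
  have iy := homothety_inv (hy n).
  by rewrite /g/= (hom_center (hx n)) -{1}(hom_center iy) (sim_dist (hom_sim iy)).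
have gB n : d (g n x) x <= d x y + d x y.
  rewrite (le_trans (dist_triangle _ y _))// (distC y) lerD// gx.
  by rewrite ler_piMl ?dist_ge0// invf_le1 ?exprn_ege1 ?ler1n.
have [g' [h' [gh' gl _]]] := isometry_limit gh gB.
exists g', h'; split => //; apply: converges_unique (gl x) _.
by apply: ultra_ext gx _; exact: ultra_mul0 cvg_expV4.
Qed.

Lemma line_through o : exists c, line c /\ c 0 = o.
Proof.
have [c cl] := dist_line M; have [g [h [gh gc]]] := isometry_transitive (c 0) o.
by exists (g \o c); split => //; exact: isometry_line gh cl.
Qed.

Lemma sphere_ex o r : 0 < r -> exists x, d x o = r.
Proof.
move=> r0; have [c [cl c0]] := line_through o.
by exists (c r); rewrite (line_dist0 _ cl c0) gtr0_norm.
Qed.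

Lemma invn_ex o (r : R) : exists w, 0 < r -> inversion d o r w.
Proof.
have [r0|r0] := pselect (0 < r); last by exists id.
by have [w iw] := inversion_ex r0 (sphere_ex o r0); exists w.
Qed.

Definition invn o r : M -> M := projT1 (cid (invn_ex o r)).

Lemma invnP o r : 0 < r -> inversion d o r (invn o r).
Proof. by rewrite /invn; case: cid => /= w; exact. Qed.

(** The conjugate by [g] of an inversion at [o] is an inversion at [g o], so uniqueness applies. *)
Lemma invn_isometry g h o r x : 0 < r -> isometry g h ->
  invn (g o) r (g x) = g (invn o r x).
Proof.
move=> r0 gh; have iw := invnP o r0.
have gK := simK gh; have hK := simVK gh; have gd := isometry_dist _ _ gh.
have ho y : y <> g o -> h y <> o by move=> + hy; apply; rewrite -hy hK.
have hd y z : d (h y) (h z) = d y z by exact: isometry_dist (isometry_inv gh).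
have hgd y : d (h y) o = d y (g o) by rewrite -gd hK.
suff iw' : inversion d (g o) r (g \o invn o r \o h).
  have := inversion_uniq r0 (sphere_ex (g o) r0) (invnP (g o) r0) iw'.
  by move=> /(_ (g x)) /=; rewrite gK.
split.
- by move=> y /=; rewrite gK (invK iw) hK.
- by rewrite /= gK (inv_center iw).
- move=> y yo /= e; apply: (inv_neq iw (ho _ yo)).
  by rewrite -[in RHS]e gK.
- by move=> y yo /=; rewrite gd (inv_distc iw (ho _ yo)) hgd.
- by move=> y z yo zo /=; rewrite gd (inv_dist iw (ho _ yo) (ho _ zo)) hd !hgd.
- move=> c cl c0 t /=.
  have := inv_line iw (isometry_line (isometry_inv gh) cl) _ t => /= ->.
    by rewrite hK.
  by rewrite c0 gK.
Qed.

(* Only the iterates of one dilation are used to blow up: unlike general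
   homotheties, they are obviously compatible with each other. *)
Definition dil o := invn o 2 \o invn o 1.
Definition dilV o := invn o 1 \o invn o 2.

Lemma dil_homothety o n :
  homothety o (4 ^+ n) (iter n (dil o)) (iter n (dilV o)).
Proof.
apply: homothety_iter; have -> : (4 : R) = 2 ^+ 2 / 1 ^+ 2.
  by rewrite expr1n divr1 -natrX.
exact: inversion_homothety (invnP _ _) (invnP _ _).
Qed.

Lemma dilV_homothety o n :
  homothety o (4 ^- n) (iter n (dilV o)) (iter n (dil o)).
Proof. exact: homothety_inv (dil_homothety o n). Qed.

Lemma dil_isometry g h o n x : isometry g h ->
  iter n (dil (g o)) (g x) = g (iter n (dil o) x).
Proof.
by move=> gh; elim: n => //= n ->; rewrite /dil/= !(invn_isometry _ _ _ gh).
Qed.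

(** Homotheties about [o] carry [c 1] to the whole positive half of [c], and the inversion at [o]
    carries that half to the negative one. *)
Lemma line_eq o c c' : line c -> line c' -> c 0 = o -> c' 0 = o ->
  c 1 = c' 1 -> c =1 c'.
Proof.
move=> cl cl' c0 c0' c1.
have pos t : 0 < t -> c t = c' t.
  move=> t0; have [g [h gh]] := homothety_ex o t0.
  by rewrite -[t]mulr1 -!(hom_line gh)// c1.
move=> t; have [t0|t0|<-] := ltgtP 0 t; first exact: pos.
- have it (e : R -> M) : line e -> e 0 = o -> e t = invn o 1 (e (- t^-1)).
    move=> el e0; rewrite (inv_line (invnP o ltr01) el e0); congr e.
    by rewrite expr1n invrN mulrN opprK mul1r invrK.
  by rewrite !it// pos// oppr_gt0 invr_lt0.
- by rewrite c0 c0'.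
Qed.

Lemma line_eq_opp o c c' : line c -> line c' -> c 0 = o -> c' 0 = o ->
  c (- 1) = c' (- 1) -> c =1 c'.
Proof.
move=> cl cl' c0 c0' cm; have := @line_eq o _ _ (line_opp cl) (line_opp cl').
by rewrite oppr0 => /(_ c0 c0' cm) h t; rewrite -[t]opprK.
Qed.

Lemma line_translation c a : line c ->
  exists g h, isometry g h /\ forall s, g (c s) = c (a + s).
Proof.
move=> cl; have k0 : (0 : R) < 4 by [].
have [g [h gh]] := homothety_ex (c 0) k0.
(* Expanding by [4] about [c 0] and contracting by [4] about [c b] is [s |-> b + (4 * s - b) / 4 = s
   + 3 / 4 * b] on the line. *)
pose b := 4 / 3 * a; have [g' [h' gh']] := homothety_ex (c b) k0.
exists (h' \o g), (h \o g'); split.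
  have := similarity_comp (similarity_inv (hom_sim gh')) (hom_sim gh).
  by rewrite mulVf.
move=> s /=; rewrite (hom_line gh)//.
have -> : c (4 * s) = c (b + (4 * s - b)) by rewrite addrC subrK.
rewrite (hom_line (homothety_inv gh') (line_shift b cl)) ?addr0//.
by congr c; rewrite /b; field.
Qed.

End Homotheties.

(** * Busemann functions *)

Section Busemann.
Context {R : realType} {M : inversiveSpace R}.
Implicit Types (x y z o : M) (u v : nat -> M).
Local Notation d := (@dist R M).
Local Notation line := (isometric_line d).

(** The reference point runs to the negative end of [c], so that the function increases along [c].
    The quantity is nonincreasing in [T], hence the infimum is the limit. *)
Definition busemann (c : R -> M) x : R :=
  inf [set d (c (- T)) x - T | T in [set T | 0 <= T]].

Lemma busemann_ge c x m : (forall T, 0 <= T -> m <= d (c (- T)) x - T) ->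
  m <= busemann c x.
Proof.
move=> mle; apply: lb_le_inf; first by exists (d (c (- 0)) x - 0), 0 => /=.
by move=> _ [T /= T0 <-]; exact: mle.
Qed.

Lemma busemann_le c x T : line c -> 0 <= T -> busemann c x <= d (c (- T)) x - T.
Proof.
move=> cl T0; apply: ge_inf; last by exists T.
exists (- d (c 0) x) => _ [S /= S0 <-].
have := dist_triangle (c (- S)) x (c 0); rewrite cl subr0 normrN ger0_norm//.
by rewrite (distC x); lra.
Qed.

Lemma busemann_mono c x S T : line c -> S <= T ->
  d (c (- T)) x - T <= d (c (- S)) x - S.
Proof.
move=> cl ST; have := dist_triangle (c (- T)) (c (- S)) x.
suff -> : d (c (- T)) (c (- S)) = T - S by lra.
by rewrite cl distrC opprK addrC ger0_norm ?subr_ge0.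
Qed.

Lemma busemann_lipschitz c x y : line c ->
  `|busemann c x - busemann c y| <= d x y.
Proof.
have h x' y' : line c -> busemann c x' - d x' y' <= busemann c y'.
  move=> cl; apply: busemann_ge => T T0; have := busemann_le x' cl T0.
  by have := dist_triangle (c (- T)) y' x'; rewrite (distC y'); lra.
move=> cl; rewrite ler_norml; have := h x y cl; have := h y x cl.
by rewrite (distC y); lra.
Qed.

Lemma busemann_line c t : line c -> busemann c (c t) = t.
Proof.
move=> cl; apply/eqP; rewrite eq_le; apply/andP; split.
  apply: le_trans (busemann_le (c t) cl (normr_ge0 t)) _.
  rewrite cl; have := ler_norm (- t); rewrite normrN => h.
  by rewrite ler0_norm; lra.
apply: busemann_ge => T T0; rewrite cl.
have -> : - T - t = - (t + T) by ring.
by rewrite normrN; have := ler_norm (t + T); lra.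
Qed.

Lemma busemann_scale k g h c e x : line c -> similarity k g h ->
  (forall t, e t = g (c (t / k))) -> busemann e (g x) = k * busemann c x.
Proof.
move=> cl gh /funext ee; have el : line e by rewrite ee; exact: line_scale gh cl.
have k0 := sim_gt0 gh; have kn0 := lt0r_neq0 k0.
have de T : d (e (- T)) (g x) - T = k * (d (c (- (T / k))) x - T / k).
  by rewrite ee (sim_dist gh) mulNr mulrBr; congr (_ - _); field.
apply/eqP; rewrite eq_le; apply/andP; split.
  rewrite -ler_pdivrMl//; apply: busemann_ge => T T0; rewrite ler_pdivrMl//.
  have -> : d (c (- T)) x - T = d (c (- (k * T / k))) x - k * T / k.
    by rewrite mulrC mulKf.
  by rewrite -de; apply: busemann_le => //; rewrite mulr_ge0// ltW.
apply: busemann_ge => T T0; rewrite de ler_pM2l//; apply: busemann_le => //.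
by rewrite divr_ge0// ltW.
Qed.

Lemma busemann_homothety c k g h x : line c -> homothety (c 0) k g h ->
  busemann c (g x) = k * busemann c x.
Proof.
move=> cl gh; apply: (busemann_scale x cl (hom_sim gh)) => t.
by rewrite (hom_line gh)// mulrC divfK// lt0r_neq0// (sim_gt0 (hom_sim gh)).
Qed.

Lemma busemann_cvg c x (T : nat -> R) : line c -> (forall n, n%:R <= T n) ->
  (fun n => d (c (- T n)) x - T n) @ \U --> busemann c x.
Proof.
move=> cl Tn; apply: ultra_cvg_oo; apply/cvgrPdist_le => e e0.
have hs : has_inf [set d (c (- T)) x - T | T in [set T | 0 <= T]].
  split; first by exists (d (c (- 0)) x - 0), 0 => /=.
  by exists (busemann c x) => _ [S /= S0 <-]; exact: busemann_le.
have [_ [S /= S0 <-] Se] := inf_adherent e0 hs.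
near=> n; have Sn : S <= T n.
  rewrite (le_trans _ (Tn n))//; near: n; exact: nbhs_infty_ger.
have := busemann_mono x cl Sn; have := busemann_le x cl (le_trans S0 Sn).
by move: Se; rewrite -/(busemann c x) ler_norml; lra.
Unshelve. all: by end_near. Qed.

Lemma busemann_converges c u x : line c -> converges u x ->
  (fun n => busemann c (u n)) @ \U --> busemann c x.
Proof. by move=> cl; apply: ultra_near => n; exact: busemann_lipschitz. Qed.

Lemma natr_le_exp4 (n : nat) : n%:R <= (4 : R) ^+ n.
Proof. by rewrite -natrX ler_nat ltnW// ltn_expl. Qed.

Lemma converges_sim k g h u x : similarity k g h -> converges u x ->
  converges (fun n => g (u n)) (g x).
Proof.
move=> gh ux; apply: ultra_ext (ultra_mul0 k ux) => n /=.
by rewrite (sim_dist gh) mulrC.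
Qed.

Lemma converges_isometries (g h : nat -> M -> M) u x y :
  (forall n, isometry (g n) (h n)) -> converges u x -> converges (g^~ x) y ->
  converges (fun n => g n (u n)) y.
Proof.
move=> gh ux; apply: converges_dist; apply: ultra_ext ux => n.
exact: isometry_dist (gh n).
Qed.

(* [dil z] and [dil o] differ by [o(r)] at distance [r] from [o]. *)
Lemma dil_sublinear o z p :
  (fun n => 4 ^- n * d (dil z (iter n (dil o) p)) (dil o (iter n (dil o) p)))
    @ \U --> (0 : R).
Proof.
have [g [h [gh go]]] := isometry_transitive o z.
pose D n := iter n (dil o); pose E n := iter n (dilV o).
have DS n : homothety o (4 ^+ n) (D n) (E n) := dil_homothety o n.
have ES n : homothety o (4 ^- n) (E n) (D n) := dilV_homothety o n.
pose gn n := E n \o g \o D n; pose hn n := E n \o h \o D n.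
have isn n : isometry (gn n) (hn n).
  have := similarity_comp (similarity_comp (hom_sim (ES n)) gh) (hom_sim (DS n)).
  by rewrite mulr1 mulVf// expf_neq0.
have gno n : d (gn n o) o = 4 ^- n * d z o.
  rewrite /gn /= (hom_center (DS n)) go -{1}(hom_center (ES n)).
  by rewrite (sim_dist (hom_sim (ES n))).
have gB n : d (gn n o) o <= d z o.
  by rewrite gno ler_piMl ?dist_ge0// invf_le1 ?exprn_ege1 ?exprn_gt0 ?ler1n.
have [k [k' [kk gk hk]]] := isometry_limit isn gB.
have ko : k o = o.
  apply: converges_unique (gk o) _.
  by apply: ultra_ext gno _; exact: ultra_mul0 cvg_expV4.
(* The rescaled isometries have a limit [k] that fixes [o]; hence [k] commutes with [dil o], and
   conjugation by it has no effect. *)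
have cv : converges (fun n => gn n (dil o (hn n p))) (dil o p).
  have <- : k (dil o (k' p)) = dil o p.
    by have := dil_isometry o 1 (k' p) kk; rewrite /= ko (simVK kk).
  apply: converges_isometries isn _ (gk _).
  exact: converges_sim (hom_sim (DS 1%N)) (hk p).
apply: ultra_ext cv => n; rewrite -(sim_dist (hom_sim (ES n))).
have Dd y : D n (dil o y) = dil o (D n y) by rewrite /D -iterSr.
congr d; last by rewrite -/(D n _) -Dd (simK (hom_sim (DS n))).
rewrite /gn /hn /= Dd (simVK (hom_sim (DS n))).
by have := dil_isometry o 1 (h (D n p)) gh; rewrite /= go (simVK gh) => ->.
Qed.

(* Ptolemy's inequality forces sublinearly asymptotic lines to have the same
   Busemann function up to a constant. *)
Lemma busemann_sublinear c e x y : line c -> line e ->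
  (fun n => 4 ^- n * d (e (- (4 * 4 ^+ n))) (c (- (4 * 4 ^+ n))))
    @ \U --> (0 : R) ->
  busemann e x - busemann e y = busemann c x - busemann c y.
Proof.
move=> cl el ec; pose T (n : nat) : R := 4 * 4 ^+ n.
have Tn n : n%:R <= T n.
  by rewrite (le_trans (natr_le_exp4 n))// /T ler_peMl ?exprn_ge0// ler1n.
have cx := @busemann_cvg c x T cl Tn; have cy := @busemann_cvg c y T cl Tn.
have ex := @busemann_cvg e x T el Tn; have ey := @busemann_cvg e y T el Tn.
set A := busemann c x in cx *; set B := busemann c y in cy *.
set A' := busemann e x in ex *; set B' := busemann e y in ey *.
set a := (fun n => _) in cx; set b := (fun n => _) in cy.
set a' := (fun n => _) in ex; set b' := (fun n => _) in ey.
suff : `|A + B' - A' - B| <= 0 by rewrite normr_le0 => /eqP; lra.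
pose q n := d x y * (4 ^- n * d (e (- T n)) (c (- T n))) / 4.
(* With [P = c (- T n)] and [Q = e (- T n)], this is [(d P x * d Q y - d Q x * d P y) / T n], each
   distance being written as [T n] plus a bounded term. Ptolemy's inequality bounds it by
   [d x y * d P Q / T n], which is [q n]. *)
pose p n := a n + b' n - a' n - b n + (a n * b' n - a' n * b n) * 4 ^- n / 4.
have pn n : `|p n| <= q n.
  have T0 : 0 < T n by rewrite mulr_gt0 ?exprn_gt0.
  have -> : p n = (d (c (- T n)) x * d (e (- T n)) y -
      d (e (- T n)) x * d (c (- T n)) y) / T n.
    rewrite /p /a /b /a' /b' /T; field; rewrite ?expf_neq0//.
  have -> : q n = d x y * d (e (- T n)) (c (- T n)) / T n.
    by rewrite /q /T; field; rewrite ?expf_neq0.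
  have Ti : 0 < (T n)^-1 by rewrite invr_gt0.
  rewrite normrM (gtr0_norm Ti) ler_pM2r//.
  set P := c _; set Q := e _; rewrite ler_norml.
  have := dist_ptolemy P Q x y; have := dist_ptolemy P Q y x.
  rewrite (distC P Q) (distC y x); lra.
have q0 : q @ \U --> (0 : R).
  by apply: ultra_ext (ultra_mul0 (d x y / 4) ec) => n; rewrite /q; ring.
have pl : p @ \U --> A + B' - A' - B + (A * B' - A' * B) * 0 / 4.
  have c0 := @cvg_expV4 R.
  apply: cvgD; first by apply: cvgB => //; apply: cvgB => //; exact: cvgD.
  apply: cvgM; last exact: cvg_cst.
  by apply: cvgM => //; apply: cvgB; exact: cvgM.
rewrite mulr0 mul0r addr0 in pl.
exact: ultra_le pn (cvg_norm pl) q0.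
Qed.

(** [dil (c 0)] preserves [c], so the image [e] of [c] under [dil z] stays at sublinear distance
    from [c] and has the same Busemann function up to a constant; composed with [dil z], that of [e]
    is [4] times that of [c]. *)
Lemma busemann_dil c z x y : line c ->
  busemann c (dil z x) - busemann c (dil z y) = 4 * (busemann c x - busemann c y).
Proof.
move=> cl; have dz := hom_sim (dil_homothety z 1); rewrite expr1 /= in dz.
pose e t := dil z (c (t / 4)).
have ee := busemann_scale _ cl dz (fun t => erefl (e t)).
rewrite mulrBr -!ee; apply/esym/busemann_sublinear => //; first exact: line_scale dz cl.
apply: ultra_ext (dil_sublinear (c 0) z (c (- 1))) => n; congr (_ * d _ _).
  rewrite /e (hom_line (dil_homothety _ n))//; congr (dil z (c _)).
  by rewrite mulrN1 mulNr mulrC mulKf.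
have := hom_line (dil_homothety (c 0) n.+1) cl erefl (-1); rewrite iterS => ->.
by rewrite mulrN1 exprS.
Qed.

(** A limit of expansions by [4 ^+ n] about [z] followed by contractions about [c 0]: the former
    multiply differences of the Busemann function by [4 ^+ n], the latter divide them. Slopes at any
    point can thus be read at [c 0]. *)
Lemma busemann_shift c z : line c -> exists g h,
  [/\ isometry g h, g z = c 0 &
      forall x y, busemann c (g x) - busemann c (g y) = busemann c x - busemann c y].
Proof.
move=> cl; set o := c 0.
pose gn n := iter n (dilV o) \o iter n (dil z).
pose hn n := iter n (dilV z) \o iter n (dil o).
have isn n : isometry (gn n) (hn n).
  have := similarity_comp (hom_sim (dilV_homothety o n)) (hom_sim (dil_homothety z n)).
  by rewrite mulVf// expf_neq0.
have gz n : d (gn n z) o = 4 ^- n * d z o.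
  rewrite /gn /= (hom_center (dil_homothety z n)).
  by rewrite -{2}(hom_center (dilV_homothety o n)) (sim_dist (hom_sim (dilV_homothety o n))).
have gB n : d (gn n z) z <= d z o + d z o.
  rewrite (le_trans (dist_triangle _ o _))// (distC o) lerD// gz.
  by rewrite ler_piMl ?dist_ge0// invf_le1 ?exprn_ege1 ?exprn_gt0 ?ler1n.
have [g [h [gh gl _]]] := isometry_limit isn gB.
exists g, h; split => //.
  apply: converges_unique (gl z) _.
  by apply: ultra_ext gz _; exact: ultra_mul0 cvg_expV4.
move=> x y.
have it n : busemann c (iter n (dil z) x) - busemann c (iter n (dil z) y) =
    4 ^+ n * (busemann c x - busemann c y).
  by elim: n => [|n IHn]; rewrite ?mul1r//= busemann_dil// IHn exprS mulrA.
have bn n : busemann c (gn n x) - busemann c (gn n y) = busemann c x - busemann c y.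
  rewrite /gn /= !(busemann_homothety _ cl (dilV_homothety o n)) -mulrBr it.
  by rewrite mulKf// expf_neq0.
apply: ultra_cvg_unique
  (cvgB (busemann_converges cl (gl x)) (busemann_converges cl (gl y))) _.
apply: ultra_ext bn _; exact: cvg_cst.
Qed.

End Busemann.

(** * Blow-up of inversions *)

Section Extremal.
Context {R : realType} {M : inversiveSpace R}.
Implicit Types (x y z o : M) (u v : nat -> M).
Local Notation d := (@dist R M).
Local Notation line := (isometric_line d).

(** All isometries fixing [o] are included because, of the similarity that a blow-up at [o]
    produces, only the factor and the fixed point are known. *)
Definition slope_bound o (c c' : R -> M) (a : R) :=
  forall g h, isometry g h -> g o = o -> busemann c' (g (c 1)) <= a.

Lemma busemann_center c o : line c -> c 0 = o -> busemann c o = 0.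
Proof. by move=> cl <-; exact: busemann_line. Qed.

Lemma slope_homogeneous o c c' a g h k : line c -> line c' -> c 0 = o ->
  c' 0 = o -> slope_bound o c c' a -> similarity k g h -> g o = o ->
  busemann c' (g (c 1)) <= k * a.
Proof.
move=> cl cl' c0 c0' sb gh go; have k0 := sim_gt0 gh.
have [f [e fe]] := homothety_ex o k0.
rewrite -ler_pdivrMl// -(simVK (hom_sim fe) (g (c 1))).
rewrite (@busemann_homothety _ _ c' k f e) ?c0'// mulKf ?gt_eqF//.
apply: (sb (e \o g) (h \o f)).
  have := similarity_comp (similarity_inv (hom_sim fe)) gh.
  by rewrite mulVf ?gt_eqF.
by rewrite /= go (hom_center (homothety_inv fe)).
Qed.

(* Blowing up [al \o w \o ga] at its fixed point [o] by dilations produces a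
   similarity, since the conformal factor of [w] is continuous. *)
Lemma blowup_asymptotic o al al' ga ga' : isometry al al' -> isometry ga ga' ->
  ga o <> o ->
  asymptotic (1 / d (ga o) o ^+ 2) (fun n =>
    iter n (dil o) \o (al \o invn o 1 \o ga) \o iter n (dilV o)).
Proof.
move=> ala gaa gao u v x y ux vy.
have P0 : 0 < d (ga o) o by exact: dist_gt0.
have key t z : converges t z ->
    converges (fun n => ga (iter n (dilV o) (t n))) (ga o).
  move=> tz.
  have tb := dist_cvg tz (converges_cst o).
  have : (fun n => 4 ^- n * d (t n) o) @ \U --> 0 * d z o.
    by apply: cvgM tb; exact: cvg_expV4.
  rewrite mul0r; apply: ultra_ext => n.
  rewrite (isometry_dist _ _ gaa) -{2}(hom_center (dilV_homothety o n)).
  by rewrite (sim_dist (hom_sim (dilV_homothety o n))).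
have du := dist_cvg (key _ _ ux) (converges_cst o).
have dv := dist_cvg (key _ _ vy) (converges_cst o).
have duv := dist_cvg ux vy.
have h : (fun n => d (u n) (v n) / (d (ga (iter n (dilV o) (u n))) o *
    d (ga (iter n (dilV o) (v n))) o)) @ \U --> d x y / (d (ga o) o * d (ga o) o).
  apply: cvgM duv _; apply: cvgV; first by rewrite mulf_neq0// gt_eqF.
  exact: cvgM.
rewrite [d x y / _]mulrC -expr2 -[X in X * d x y]mul1r in h.
apply: ultra_ext_near h; near=> n.
have un : ga (iter n (dilV o) (u n)) <> o.
  by apply: dist_neq; near: n; exact: (cvgr_gt _ du).
have vn : ga (iter n (dilV o) (v n)) <> o.
  by apply: dist_neq; near: n; exact: (cvgr_gt _ dv).
rewrite /= (sim_dist (hom_sim (dil_homothety o n))) (isometry_dist _ _ ala).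
rewrite (inv_dist (invnP o ltr01))// (isometry_dist _ _ gaa).
rewrite (sim_dist (hom_sim (dilV_homothety o n))) expr1n mul1r.
by field; rewrite !dist_neq0// expf_neq0.
Unshelve. all: by end_near. Qed.

Lemma blowup o al al' ga ga' : isometry al al' -> isometry ga ga' ->
  ga o <> o -> al (invn o 1 (ga o)) = o ->
  exists g h, [/\ similarity (1 / d (ga o) o ^+ 2) g h, g o = o &
    forall x, converges (fun n =>
      iter n (dil o) (al (invn o 1 (ga (iter n (dilV o) x))))) (g x)].
Proof.
move=> ala gaa gao Qo; have iw := invnP o (@ltr01 R).
have alK := simK ala; have alVK := simVK ala.
have gaK := simK gaa; have gaVK := simVK gaa.
pose G n := iter n (dil o) \o (al \o invn o 1 \o ga) \o iter n (dilV o).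
(* [H n] inverts [G n] and has the same form, with [ga'] and [al'] in place of [al] and [ga]; as
   [d (al' o) o = 1 / d (ga o) o], its asymptotic factor is the inverse one. *)
pose H n := iter n (dil o) \o (ga' \o invn o 1 \o al') \o iter n (dilV o).
have alo : al' o = invn o 1 (ga o) by rewrite -{1}Qo alK.
have Qo' : ga' (invn o 1 (al' o)) = o by rewrite alo (invK iw) gaK.
have alo' : al' o <> o.
  by rewrite alo; exact: inv_neq_center iw gao.
have D n := hom_sim (dil_homothety o n).
have Go n : G n o = o.
  rewrite /G /= (hom_center (dilV_homothety o n)) Qo.
  exact: hom_center (dil_homothety o n).
have Ho n : H n o = o.
  rewrite /H /= (hom_center (dilV_homothety o n)) Qo'.
  exact: hom_center (dil_homothety o n).
have P0 : d (ga o) o != 0 by exact: dist_neq0.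
have [|||||||g [h [gh gl _]]] :=
    @asymptotic_limit _ M (1 / d (ga o) o ^+ 2) G H o 0.
- by rewrite divr_gt0// exprn_gt0// dist_gt0.
- by move=> n x; rewrite /G /H /= (simK (D n)) alK (invK iw) gaK (simVK (D n)).
- by move=> n x; rewrite /G /H /= (simK (D n)) gaVK (invK iw) alVK (simVK (D n)).
- exact: blowup_asymptotic ala gaa gao.
- have := blowup_asymptotic (isometry_inv gaa) (isometry_inv ala) alo'.
  rewrite {1}alo (inv_distc iw gao) expr1n.
  by have -> : 1 / (1 / d (ga o) o) ^+ 2 = (1 / d (ga o) o ^+ 2)^-1 by field.
- by move=> n; rewrite Go distxx.
- by move=> n; rewrite Ho distxx.
exists g, h; split => //.
by apply: converges_unique (gl o) _; rewrite /converges;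
  under eq_fun do rewrite Go; exact: converges_cst.
Qed.

(** The inverted point is moved to [o] by an isometry that preserves differences of the Busemann
    function of [c']; the blow-up there is a similarity of factor [1 / d (J (c x)) o ^+ 2], which
    scales the slope bound [a]. The step [s] is some [4 ^- n], so that only a lower right Dini
    derivative is bounded. *)
Lemma invn_line_derivative o c c' J J' (a x e delta : R) :
  line c -> line c' -> c 0 = o -> c' 0 = o -> slope_bound o c c' a ->
  isometry J J' -> J (c x) <> o -> 0 < e -> 0 < delta ->
  exists s, [/\ 0 < s, s < delta &
    busemann c' (invn o 1 (J (c (x + s)))) - busemann c' (invn o 1 (J (c x))) <=
    (a / d (J (c x)) o ^+ 2 + e) * s].
Proof.
move=> cl cl' c0 c0' sb JJ Jx e0 delta0.
have [tr [tr' [trI trc]]] := line_translation x cl.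
have [al [al' [alI al0 alb]]] := busemann_shift (invn o 1 (J (c x))) cl'.
pose ga := J \o tr; have gaI := isometry_comp JJ trI.
have gac s : ga (c s) = J (c (x + s)) by rewrite /ga /= trc.
have gao : ga o = J (c x) by rewrite -c0 gac addr0.
have [||g [h [gh go gl]]] := @blowup o al al' ga _ alI gaI; first by rewrite gao.
  by rewrite gao al0.
rewrite gao in gh.
have := slope_homogeneous cl cl' c0 c0' sb gh go.
set L := busemann c' _ => Lle.
have /cvgrPdist_lt/(_ _ e0) := busemann_converges cl' (gl (c 1)) => nr.
have : \forall n \near \U, (4 : R) ^- n < delta.
  by apply: (cvgr_lt _ (@cvg_expV4 R)).
move=> /(filterI nr)/filter_ex[n [/= dn sn]].
have s0 : 0 < (4 : R) ^- n by rewrite invr_gt0 exprn_gt0.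
exists (4 ^- n); split => //.
move: dn; rewrite (hom_line (dilV_homothety o n) cl c0) mulr1 -/(ga _) gac.
have dh : homothety (c' 0) (4 ^+ n) (iter n (dil o)) (iter n (dilV o)).
  by rewrite c0'; exact: dil_homothety.
rewrite (busemann_homothety _ cl' dh).
have -> : busemann c' (al (invn o 1 (J (c (x + 4 ^- n))))) =
    busemann c' (invn o 1 (J (c (x + 4 ^- n)))) -
    busemann c' (invn o 1 (J (c x))).
  by rewrite -alb al0 (busemann_line 0 cl') subr0.
set F := busemann c' _ - busemann c' _ => dn.
have : 4 ^+ n * F <= a / d (J (c x)) o ^+ 2 + e.
  move: dn; rewrite -/L ltr_norml => /andP[dn _].
  have -> : a / d (J (c x)) o ^+ 2 = 1 / d (J (c x)) o ^+ 2 * a by ring.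
  lra.
by rewrite -ler_pdivlMl ?exprn_gt0// mulrC.
Qed.

End Extremal.

(** * Transitivity on lines *)

Section LineTransitivity.
Context {R : realType} {M : inversiveSpace R}.
Implicit Types (o : M).
Local Notation d := (@dist R M).
Local Notation line := (isometric_line d).

(** If [G a < G b], let [e] be half the mean slope: the last [y] with [G y - G a <= e * (y - a)]
    exists by continuity, differs from [b], and can be pushed further by a small step. *)
Lemma dini_le (G : R -> R) (a b : R) : a <= b ->
  (forall x, a <= x <= b -> {for x, continuous G}) ->
  (forall x e delta, a <= x < b -> 0 < e -> 0 < delta ->
    exists s, [/\ 0 < s, s < delta & G (x + s) - G x <= e * s]) ->
  G b <= G a.
Proof.
rewrite le_eqVlt => /predU1P[-> //|ab] Gc Gd; rewrite leNgt; apply/negP => Gab.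
pose e := (G b - G a) / (b - a) / 2.
have ba0 : 0 < b - a by rewrite subr_gt0.
have e0 : 0 < e by rewrite !divr_gt0// subr_gt0.
have eE : 2 * (e * (b - a)) = G b - G a by rewrite /e; field; rewrite gt_eqF.
pose S := [set y | a <= y <= b /\ G y - G a <= e * (y - a)].
have Sa : S a by rewrite /S/= lexx ltW// !subrr mulr0.
have Sb : has_ubound S by exists b => y [/andP[]].
have hS : has_sup S by split => //; exists a.
set s := sup S.
have as_ : a <= s by exact: sup_upper_bound.
have sb : s <= b by apply: sup_le_ub; [exists a | move=> y [/andP[]]].
have Ss : G s - G a <= e * (s - a).
  rewrite leNgt; apply/negP => lt; pose gap := G s - G a - e * (s - a).
  have gap0 : 0 < gap by rewrite subr_gt0.
  have /(_ _) := Gc s; rewrite as_ sb => /(_ isT)/cvgrPdist_lt/(_ _ gap0).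
  move=> /nbhs_ballP[r /= r0 rb].
  have [y [/andP[ay yb] Sy] sy] := sup_adherent r0 hS.
  have ys : y <= s by apply: sup_upper_bound => //; split => //; rewrite ay yb.
  have := rb y; rewrite /ball/= ger0_norm ?subr_ge0// => /(_ _).
  have /[swap]/[apply] : s - y < r by move: sy; rewrite -/s; lra.
  rewrite ltr_norml => /andP[_ h].
  have : e * (y - a) <= e * (s - a) by rewrite ler_pM2l//; lra.
  by rewrite /gap in h; lra.
have sb' : s < b.
  rewrite lt_neqAle sb andbT; apply/eqP => sb'; move: Ss; rewrite sb'.
  have : 0 < e * (b - a) by rewrite mulr_gt0.
  lra.
have bs0 : 0 < b - s by rewrite subr_gt0.
have [|t [t0 tb Gt]] := Gd s e (b - s) _ e0 bs0; first by rewrite as_ sb'.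
have : S (s + t).
  split; first by apply/andP; split; lra.
  have -> : e * (s + t - a) = e * t + e * (s - a) by ring.
  lra.
by move=> /(sup_upper_bound hS); rewrite -/s; lra.
Qed.

Section Profile.
Variables (o : M) (c c' : R -> M) (J J' : M -> M).
Hypotheses (cl : line c) (cl' : line c') (c0 : c 0 = o) (c0' : c' 0 = o).
Hypothesis JI : isometry J J'.

Let F x := busemann c' (invn o 1 (J (c x))).

Lemma profile_bound x : J (c x) <> o -> `|F x| <= 1 / d (J (c x)) o.
Proof.
move=> xo; have := busemann_lipschitz (invn o 1 (J (c x))) o cl'.
by rewrite (busemann_center cl' c0') subr0 (inv_distc (invnP o ltr01) xo) expr1n.
Qed.

Lemma profile_continuous x : J (c x) <> o -> {for x, continuous F}.
Proof.
move=> xo; have f0 := dist_gt0 xo; set f := d _ _ in f0.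
apply/cvgrPdist_le => e e0; near=> y.
have xy : `|x - y| <= Num.min (f / 2) (e * (f * (f / 2))).
  near: y; apply: (@cvgr_dist_le _ _ _ _ _ id x) => //.
  by rewrite lt_min divr_gt0// mulr_gt0// mulr_gt0// divr_gt0.
move: xy; rewrite le_min => /andP[xy1 xy2].
have xyd : d (J (c x)) (J (c y)) = `|x - y| by rewrite (isometry_dist _ _ JI).
have fy : f / 2 <= d (J (c y)) o.
  by have := dist_triangle (J (c x)) (J (c y)) o; rewrite xyd -/f; lra.
have fy0 : 0 < d (J (c y)) o by apply: lt_le_trans fy; rewrite divr_gt0.
have yo : J (c y) <> o by exact: dist_neq.
rewrite (le_trans (busemann_lipschitz _ _ cl'))//.
rewrite (inv_dist (invnP o ltr01))// expr1n mul1r xyd -/f.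
rewrite ler_pdivrMr ?mulr_gt0// (le_trans xy2)// ler_pM2l// ler_pM2l//.
Unshelve. all: by end_near. Qed.

End Profile.

Lemma busemann_slope o c c' x : line c -> line c' -> c 0 = o -> c' 0 = o ->
  0 <= x -> busemann c' (c x) = x * busemann c' (c 1).
Proof.
move=> cl cl' c0 c0'; rewrite le_eqVlt => /predU1P[<-|x0].
  by rewrite c0 (busemann_center cl' c0') mul0r.
have [g [h gh]] := homothety_ex o x0.
rewrite -{1}[x]mulr1 -(hom_line gh cl c0).
by apply: busemann_homothety cl' _; rewrite c0'; exact: gh.
Qed.

(** Slopes are at most [1] by the Lipschitz property, and a maximising sequence of isometries fixing
    [o] has a limit that fixes [o] and attains the supremum. *)
Lemma slope_max o c c' : line c -> line c' -> c 0 = o -> c' 0 = o ->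
  exists g h, [/\ isometry g h, g o = o &
    slope_bound o (g \o c) c' (busemann c' (g (c 1)))].
Proof.
move=> cl cl' c0 c0'.
pose A := [set a | exists g h, [/\ isometry g h, g o = o & a = busemann c' (g (c 1))]].
have A0 : A (busemann c' (c 1)) by exists id, id; split => //; exact: similarity_id.
have Ab : ubound A 1.
  move=> _ [g [h [gh go ->]]].
  have := busemann_lipschitz (g (c 1)) (g (c 0)) cl'.
  rewrite (isometry_dist _ _ gh) cl c0 go (busemann_center cl' c0') !subr0 normr1.
  exact: le_trans (ler_norm _).
have hA : has_sup A by split; [exists (busemann c' (c 1)) | exists 1].
have hn n : exists gh : (M -> M) * (M -> M), [/\ isometry gh.1 gh.2, gh.1 o = o &
    sup A - 4 ^- n < busemann c' (gh.1 (c 1))].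
  have e0 : (0 : R) < 4 ^- n by rewrite invr_gt0 exprn_gt0.
  by have [_ [g [h [gh go ->]]] lt] := sup_adherent e0 hA; exists (g, h).
have [gh {}hn] := choice hn.
pose g n := (gh n).1; pose h n := (gh n).2.
have ghI n : isometry (g n) (h n) by have [] := hn n.
have gB n : d (g n o) o <= 0 by have [_ + _] := hn n; rewrite /g => ->; rewrite distxx.
have [k [k' [kk gk _]]] := isometry_limit ghI gB.
have ko : k o = o.
  apply: converges_unique (gk o) _; apply: ultra_ext (@cvg_cst _ _ _ _ _) => n.
  by have [_ + _] := hn n; rewrite /g => ->; rewrite distxx.
exists k, k'; split => // f f' ff fo /=.
have sA : busemann c' (f (k (c 1))) <= sup A.
  apply: sup_upper_bound => //; exists (f \o k), (k' \o f'); split => //.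
  - exact: isometry_comp.
  - by rewrite /= ko.
apply: (le_trans sA).
have l0 : (fun n => sup A - 4 ^- n) @ \U --> sup A.
  rewrite -[X in _ --> X]subr0; apply: cvgB; [exact: cvg_cst | exact: cvg_expV4].
apply: ultra_le l0 (busemann_converges cl' (gk (c 1))) => n.
by have [_ _ /ltW] := hn n.
Qed.

(* Along [x |-> invn o 1 (J (c x))], a circle arc from [c' (- 1)] to [o], the
   Busemann function of [c'] grows by [1] at speed at most [a / f x ^+ 2],
   where [f x >= 1 + a * x] and [f x >= x - 1]; this is impossible if
   [a < 1]. *)
Lemma extremal_slope o c c' : line c -> line c' -> c 0 = o -> c' 0 = o ->
  slope_bound o c c' (busemann c' (c 1)) -> c 1 <> c' (- 1) ->
  1 <= busemann c' (c 1).
Proof.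
move=> cl cl' c0 c0'; set a := busemann c' (c 1) => sb c1.
rewrite leNgt; apply/negP => a1.
have [J [J' [JI Jc]]] := line_translation 1 cl'.
have Jm : J (c' (- 1)) = o by rewrite Jc subrr.
pose f x := d (J (c x)) o.
have fE x : f x = d (c x) (c' (- 1)) by rewrite /f -Jm (isometry_dist _ _ JI).
have f1 x : 0 <= x -> 1 + a * x <= f x.
  move=> x0; have := busemann_le (c x) cl' ler01.
  by rewrite (busemann_slope cl cl' c0 c0' x0) -/a fE distC; lra.
have f2 x : x - 1 <= f x.
  have := dist_triangle (c x) (c' (- 1)) o; rewrite -fE.
  rewrite (line_dist0 _ cl c0) (line_dist0 _ cl' c0') normrN normr1.
  by have := ler_norm x; lra.
(* By the distance to [o], the line [c] could meet [c' (- 1)] only at [x = 1], which [c1]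
   excludes. *)
have Jo x : 0 <= x -> J (c x) <> o.
  move=> x0 e; apply: c1; have e' : c x = c' (- 1).
    by apply: (similarity_inj JI); rewrite Jm.
  have := line_dist0 x cl c0; rewrite e' (line_dist0 _ cl' c0') normrN normr1.
  by rewrite ger0_norm// => x1; rewrite -e' -x1.
have f0 x : 0 <= x -> 0 < f x by move=> /Jo; exact: dist_gt0.
pose F x := busemann c' (invn o 1 (J (c x))).
have F0 : F 0 = - 1.
  rewrite /F c0 -c0' Jc addr0 (inv_line (invnP (c' 0) ltr01) cl' erefl).
  by rewrite expr1n divr1 busemann_line.
have Fb x : 0 <= x -> - (1 / f x) <= F x.
  move=> x0; have := @profile_bound o c c' J cl' c0' x (Jo x x0).
  by rewrite -/(F x) ler_norml => /andP[].
have Fd x e delta : 0 <= x -> 0 < e -> 0 < delta -> exists s,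
    [/\ 0 < s, s < delta & F (x + s) - F x <= (a / f x ^+ 2 + e) * s].
  by move=> /Jo x0; exact: (invn_line_derivative cl cl' c0 c0' sb JI x0).
have Fc x : 0 <= x -> {for x, continuous F}.
  by move=> x0; exact: (@profile_continuous o c c' J J' cl cl' JI x (Jo x x0)).
(* If [a <= 0], then [F] does not increase, so [F 3 <= - 1]; but [f 3 >= 2] forces
   [F 3 >= - 1 / 2]. *)
have [a0|a0] := leP a 0.
  have : F 3 <= F 0.
    apply: dini_le => [//|x /andP[x0 _]|x e delta /andP[x0 _] e0 delta0].
      exact: Fc.
    have [s [s0 sd Fs]] := Fd x e delta x0 e0 delta0.
    exists s; split => //; apply: (le_trans Fs); rewrite ler_pM2r// gerDr.
    by rewrite mulr_le0_ge0// invr_ge0 exprn_ge0// ltW// f0.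
  have h3 : (0 : R) <= 3 by [].
  have := Fb _ h3; have := f2 3; rewrite F0 => f3 F3 F3'.
  have : 1 / f 3 <= 1 / 2 by rewrite ler_pM2l// lef_pV2 ?posrE ?f0//; lra.
  lra.
(* The estimates below lead to [b - 1 <= 1 + a * b], that is [b * (1 - a) <= 2]; the summand [2]
   makes this fail. *)
pose b := 2 / (1 - a) + 2.
have a10 : 0 < 1 - a by rewrite subr_gt0.
have b2 : 2 < b by rewrite ltrDr divr_gt0.
have b0 : 0 <= b by lra.
have bE : b * (1 - a) = 2 + 2 * (1 - a) by rewrite /b; field; rewrite gt_eqF.
(* The primitive of [a / (1 + a * x) ^+ 2] that vanishes at [0]. Once [F - Phi] is nonincreasing,
   [F b <= - 1 / (1 + a * b)]. *)
pose Phi x := a * x / (1 + a * x).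
have den x : 0 <= x -> 0 < 1 + a * x.
  by move=> x0; rewrite ltr_wpDr// mulr_ge0// ltW.
have : F b - Phi b <= F 0 - Phi 0.
  apply: (@dini_le (fun x => F x - Phi x)) =>
    [//|x /andP[x0 _]|x e delta /andP[x0 _] e0 delta0].
    apply: continuousB; first exact: Fc.
    apply: cvgM; first by apply: cvgM; [exact: cvg_cst | exact: cvg_id].
    apply: cvgV; first by rewrite gt_eqF// den.
    apply: cvgD; first exact: cvg_cst.
    by apply: cvgM; [exact: cvg_cst | exact: cvg_id].
  have e20 : 0 < e / 2 by rewrite divr_gt0.
  (* One half of [e] is the error in the bound for [F]; the other pays for passing from [a / D ^+ 2]
     to the difference quotient of [Phi], which costs at most [s]. *)
  have [|s [s0 sd Fs]] := Fd x (e / 2) (Num.min delta (e / 2)) x0 e20.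
    by rewrite lt_min delta0.
  move: sd; rewrite lt_min => /andP[sd se].
  exists s; split => //.
  have D0 := den _ x0; set D := 1 + a * x in D0.
  have Ds : 1 + a * (x + s) = D + a * s by rewrite /D; ring.
  have as0 : 0 < a * s by rewrite mulr_gt0.
  have Ds0 : 0 < D + a * s by rewrite addr_gt0.
  have D1 : 1 <= D by rewrite lerDl mulr_ge0// ltW.
  have PhiE : Phi (x + s) - Phi x = a / (D * (D + a * s)) * s.
    have axE : a * x = D - 1 by rewrite /D; ring.
    by rewrite /Phi Ds -/D mulrDr axE; field; rewrite !gt_eqF.
  have fD : a / f x ^+ 2 <= a / D ^+ 2.
    rewrite ler_pM2l// lef_pV2 ?posrE ?exprn_gt0 ?f0//.
    by rewrite ler_sqr ?nnegrE ?(ltW D0) ?(ltW (f0 _ x0))//; exact: (f1 x x0).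
  have gapE : a / D ^+ 2 - a / (D * (D + a * s)) = a * a * s / (D ^+ 2 * (D + a * s)).
    by field; rewrite !gt_eqF.
  have gap : a * a * s / (D ^+ 2 * (D + a * s)) <= s.
    rewrite ler_pdivrMr; last by rewrite mulr_gt0 ?exprn_gt0.
    rewrite mulrC ler_pM2l//; apply: le_trans (_ : 1 <= _).
      by rewrite mulr_ile1// ltW.
    by rewrite mulr_ege1 ?exprn_ege1//; lra.
  have -> : F (x + s) - Phi (x + s) - (F x - Phi x) =
      F (x + s) - F x - (Phi (x + s) - Phi x) by ring.
  rewrite PhiE; apply: le_trans (_ : (a / f x ^+ 2 + e / 2 - a / (D * (D + a * s))) * s <= _).
    by rewrite mulrBl lerD2r.
  by rewrite ler_pM2r//; lra.
rewrite F0 /Phi mulr0 mul0r subr0.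
have Db := den _ b0.
have -> : a * b / (1 + a * b) = 1 - 1 / (1 + a * b) by field; rewrite gt_eqF.
have := Fb _ b0 => Fbb Fle.
have : 1 / (1 + a * b) <= 1 / (b - 1).
  apply: le_trans (_ : 1 / f b <= _); first lra.
  by rewrite ler_pM2l// lef_pV2 ?posrE ?f0//; have := f2 b; lra.
rewrite ler_pM2l// lef_pV2 ?posrE//; first by lra.
by rewrite subr_gt0; lra.
Qed.

(* If the slope is [1], the negative half of [c'] and the positive half of [c]
   form a line; inversions preserve it, and they exchange its halves. *)
Lemma slope1_eq o c c' : line c -> line c' -> c 0 = o -> c' 0 = o ->
  1 <= busemann c' (c 1) -> c =1 c'.
Proof.
move=> cl cl' c0 c0' b1.
have dS S T : 0 <= S -> 0 <= T -> d (c' (- T)) (c S) = S + T.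
  move=> S0 T0; apply/eqP; rewrite eq_le; apply/andP; split.
    have := dist_triangle (c' (- T)) o (c S).
    rewrite (distC o) (line_dist0 _ cl c0) (line_dist0 _ cl' c0') normrN.
    by rewrite !ger0_norm//; lra.
  have := busemann_le (c S) cl' T0; rewrite (busemann_slope cl cl' c0 c0' S0).
  have : S * 1 <= S * busemann c' (c 1) by rewrite ler_wpM2l.
  lra.
pose e t := if t <= 0 then c' t else c t.
have e0 : e 0 = o by rewrite /e lexx.
have el : line e.
  have mixed s t : s <= 0 -> 0 < t -> d (c' s) (c t) = `|s - t|.
    move=> s0 t0; rewrite -[s in LHS]opprK dS ?oppr_ge0//; last exact: ltW.
    by rewrite ler0_norm; lra.
  move=> s t; rewrite /e; case: ifPn => s0; case: ifPn => t0 //.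
  - by rewrite mixed// ltNge.
  - by rewrite distC mixed ?ltNge// distrC.
have iw := invnP o (@ltr01 R).
have cm : c (- 1) = c' (- 1).
  have := inv_line iw el e0 1; have := inv_line iw cl c0 1.
  rewrite expr1n divr1 {1}/e lt_geF// => -> ->.
  by rewrite /e oppr_le0 ler01.
exact: line_eq_opp cl cl' c0 c0' cm.
Qed.

Lemma isometry_generic_lines o c c' : line c -> line c' -> c 0 = o -> c' 0 = o ->
  c 1 <> c' (- 1) ->
  exists g h, [/\ isometry g h, g o = o & forall t, g (c t) = c' t].
Proof.
move=> cl cl' c0 c0' c1.
have [g [h [gh go sb]]] := slope_max cl cl' c0 c0'.
have gcl := isometry_line gh cl.
have gc0 : (g \o c) 0 = o by rewrite /= c0.
have [gc1|gc1] := pselect (g (c 1) = c' (- 1)).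
  (* The maximal slope is now [- 1], the least value that the Lipschitz property allows, so [c]
     itself is extremal and can replace [g \o c]. *)
  have sb' : slope_bound o c c' (busemann c' (c 1)).
    move=> f f' ff fo; apply: (@le_trans _ _ (busemann c' (g (c 1)))).
      have ho : h o = o by rewrite -{1}go (simK gh).
      have := sb (f \o h) (g \o f') (isometry_comp ff (isometry_inv gh)).
      by rewrite /= ho fo (simK gh); exact.
    rewrite gc1 busemann_line//.
    have := busemann_lipschitz (c 1) o cl'.
    rewrite (busemann_center cl' c0') subr0 (line_dist0 _ cl c0) normr1.
    by rewrite ler_norml => /andP[].
  exists id, id; split => //; first exact: similarity_id.
  exact: slope1_eq cl cl' c0 c0' (extremal_slope cl cl' c0 c0' sb' c1).
exists g, h; split => //.
exact: slope1_eq gcl cl' gc0 c0' (extremal_slope gcl cl' gc0 c0' sb gc1).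
Qed.

Lemma line_reflection c : line c -> (forall z, exists t, z = c t) ->
  exists g h, isometry g h /\ forall t, g (c t) = c (- t).
Proof.
move=> cl /choice[f fE].
have fc t : f (c t) = t by apply: (line_inj cl); rewrite -fE.
exists (fun z => c (- f z)), (fun z => c (- f z)).
split; last by move=> t; rewrite fc.
have gK : involutive (fun z => c (- f z)) by move=> z; rewrite fc opprK -fE.
split => // x y; rewrite mul1r cl {2}(fE x) {2}(fE y) cl.
by rewrite -normrN; congr `|_|; ring.
Qed.

(* In the last case all the isometries fixing [o] preserve [c], so that the
   Busemann function would decrease all around a closed circle. *)
Lemma isometry_opposite_lines o c : line c -> c 0 = o ->
  exists g h, [/\ isometry g h, g o = o & forall t, g (c (- t)) = c t].
Proof.
move=> cl c0; have iw := invnP o (@ltr01 R).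
pose e t := c (- t); have el : line e by exact: line_opp.
have e0 : e 0 = o by rewrite /e oppr0.
have [[f [fl f0 f1 fm1]]|no3] := pselect (exists f, [/\ line f, f 0 = o,
    f 1 <> c 1 & f 1 <> c (- 1)]).
  have [|g [h [gh go ge]]] := isometry_generic_lines el fl e0 f0.
    by move=> ef; apply: f1; exact: line_eq_opp fl cl f0 c0 (esym ef) 1.
  have [g' [h' [gh' go' ge']]] := isometry_generic_lines fl cl f0 c0 fm1.
  exists (g' \o g), (h \o h'); split; first exact: isometry_comp.
    by rewrite /= go.
  by move=> t; rewrite /= ge ge'.
have [cT|] := pselect (forall z, exists t, z = c t).
  have [g [h [gh gc]]] := line_reflection cl cT.
  exists g, h; split => //; first by rewrite -{1}c0 gc oppr0.
  by move=> t; rewrite gc opprK.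
move=> /existsNP[z /forallNP zc].
(* The image of [z] under inversion is off [c], as inversion preserves [c]. By [no3] the only lines
   through [o] are [c] and its reverse, so a line through that image misses [o]. *)
have [J [J' [JI Jo]]] := isometry_transitive o (invn o 1 z).
have Jel := isometry_line JI el.
have zE t : invn o 1 z <> c t.
  move=> zt; apply: (zc (- (1 ^+ 2 / t))).
  by rewrite -(inv_line iw cl c0) -zt (invK iw).
have Jn x : J (e x) <> o.
  move=> Jx; apply: no3; exists (fun t => J (e (x + t))); split.
  - exact: (line_shift x Jel).
  - by rewrite addr0.
  - move=> e1; apply: (zE (- x)).
    have h : (fun t => J (e (x + t))) =1 c.
      by apply: (line_eq (line_shift x Jel) cl) c0 e1; rewrite /= addr0.
    by rewrite -(h (- x)) subrr e0 Jo.
  - move=> e1; apply: (zE x).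
    have h : (fun t => J (e (x + t))) =1 e.
      by apply: (line_eq (line_shift x Jel) el) e0 e1; rewrite /= addr0.
    by rewrite -[x in RHS]opprK -/(e (- x)) -(h (- x)) subrr e0 Jo.
have [g [h [gh go sb]]] := slope_max el cl e0 c0.
have [gc1|gc1] := pselect (g (e 1) = c (- 1)); last first.
  have gel := isometry_line gh el; have ge0 : (g \o e) 0 = o by rewrite /= e0.
  have [g' [h' [gh' go' ge']]] := isometry_generic_lines gel cl ge0 c0 gc1.
  exists (g' \o g), (h \o h'); split; first exact: isometry_comp.
    by rewrite /= go.
  exact: ge'.
(* Now every isometry fixing [o] gives slope at most [- 1], so the Busemann function decreases along
   the whole inverted line. *)
rewrite gc1 busemann_line// in sb.
have sb' : slope_bound o e c (- 1).
  move=> f f' ff fo; have ho : h o = o by rewrite -{1}go (simK gh).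
  have := sb (f \o h) (g \o f') (isometry_comp ff (isometry_inv gh)).
  by rewrite /= ho fo (simK gh); exact.
pose F x := busemann c (invn o 1 (J (e x))).
pose f x := d (J (e x)) o.
have f0 x : 0 < f x by exact: dist_gt0.
have Fd x eps delta : 0 < eps -> 0 < delta -> exists s,
    [/\ 0 < s, s < delta & F (x + s) - F x <= (- 1 / f x ^+ 2 + eps) * s].
  exact: (invn_line_derivative el cl e0 c0 sb' JI (Jn x)).
have Fmono a b : a <= b -> F b <= F a.
  move=> ab; apply: dini_le => // [x _|x eps delta _ eps0 delta0].
    exact: (@profile_continuous o e c J J' el cl JI x (Jn x)).
  have [s [s0 sd Fs]] := Fd x eps delta eps0 delta0.
  exists s; split => //; apply: (le_trans Fs); rewrite ler_pM2r// gerDr.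
  by rewrite mulNr oppr_le0 divr_ge0// exprn_ge0// ltW.
have Fb x : `|F x| <= 1 / f x by exact: (@profile_bound o e c J cl c0 x (Jn x)).
have fx x : `|x| - f 0 <= f x.
  have := dist_triangle (J (e x)) o (J (e 0)).
  by rewrite (isometry_dist _ _ JI) el subr0 (distC o) -/(f x) -/(f 0); lra.
(* Both ends of the inverted line tend to [o], where the Busemann function vanishes. A nonincreasing
   [F] with limit [0] at both ends is zero, against the strict decrease at [0]. *)
have Fsmall eps : 0 < eps -> exists b, forall x, b <= `|x| -> `|F x| <= eps.
  move=> eps0; exists (f 0 + 1 / eps) => x bx.
  rewrite (le_trans (Fb x))// ler_pdivrMr// mulrC -ler_pdivrMr//.
  by have := fx x; lra.
have F_ge0 x : 0 <= F x.
  rewrite leNgt; apply/negP => Fx.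
  have [|b bF] := Fsmall (- F x / 2); first by rewrite divr_gt0// oppr_gt0.
  pose y := Num.max x b.
  have yx : F y <= F x by apply: Fmono; rewrite le_max lexx.
  have : `|F y| <= - F x / 2.
    by apply: bF; rewrite (le_trans _ (ler_norm _))// le_max lexx orbT.
  by rewrite ler_norml => /andP[]; lra.
have F_le0 x : F x <= 0.
  rewrite leNgt; apply/negP => Fx.
  have [|b bF] := Fsmall (F x / 2); first by rewrite divr_gt0.
  pose y := Num.min x (- b).
  have yx : F x <= F y by apply: Fmono; rewrite ge_min lexx.
  have : `|F y| <= F x / 2.
    apply: bF; rewrite -normrN (le_trans _ (ler_norm _))// lerNr.
    by rewrite ge_min lexx orbT.
  by rewrite ler_norml => /andP[]; lra.
have eps0 : 0 < 1 / f 0 ^+ 2 / 2 by rewrite !divr_gt0// exprn_gt0.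
have [s [s0 _]] := Fd 0 _ _ eps0 ltr01.
have -> : - 1 / f 0 ^+ 2 + 1 / f 0 ^+ 2 / 2 = - (1 / f 0 ^+ 2 / 2).
  by field; rewrite gt_eqF.
have := F_ge0 (0 + s); have := F_le0 0.
have : 0 < 1 / f 0 ^+ 2 / 2 * s by rewrite mulr_gt0.
by rewrite mulNr; lra.
Qed.

Lemma isometry_lines o c c' : line c -> line c' -> c 0 = o -> c' 0 = o ->
  exists g h, isometry g h /\ forall t, g (c t) = c' t.
Proof.
move=> cl cl' c0 c0'; have [c1|c1] := pselect (c 1 = c' (- 1)).
  have cE := line_eq cl (line_opp cl') c0 _ c1; rewrite oppr0 in cE.
  have [g [h [gh _ gc]]] := isometry_opposite_lines cl' c0'.
  by exists g, h; split => // t; rewrite cE.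
by have [g [h [gh _ gc]]] := isometry_generic_lines cl cl' c0 c0' c1; exists g, h.
Qed.

End LineTransitivity.

(** * The metric with a given remote point *)

Section CompactUltra.
Context {T : topologicalType}.

Lemma compact_free_ultra (u : nat -> T) : compact [set: T] ->
  exists p : T, u @ \U --> p.
Proof.
move=> Tc; have [|p [_ up]] := Tc (u @ \U) _; first exact: filterT.
exists p => V pV; have [//|UV] := @in_ultra_setVsetC _ \U (u @^-1` V) _.
by have [x []] := up (~` V) V UV pV.
Qed.

End CompactUltra.

Section PunctureMetric.
Context {R : realType} (X : mobiusSpace R).
Implicit Types x y z u w : X.
Local Notation m := (mobius_metric X).

(** With infinite distances counted as [1], cross-ratio triples are triples of plain products, and
    identities between them treat remote and other points alike. *)
Definition fdist x y : R := cancel_oo (m x y).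

Definition remote_pt x : Prop := remote m = Some x.

Lemma remote_uniq x y : remote_pt x -> remote_pt y -> x = y.
Proof. by rewrite /remote_pt => -> []. Qed.

Lemma fdistxx x : fdist x x = 0.
Proof. by rewrite /fdist (xdist_eq0 m x x).2. Qed.

Lemma fdistC x y : fdist x y = fdist y x.
Proof. by rewrite /fdist xdistC. Qed.

Lemma fdist_remote x y : remote_pt x -> x <> y -> fdist x y = 1.
Proof.
by move=> rx xy; rewrite /fdist (xdist_pinfty m x y).2//; split => //; left.
Qed.

Lemma mdistE x y : ~ remote_pt x -> ~ remote_pt y -> m x y = (fdist x y)%:E.
Proof.
move=> rx ry; rewrite /fdist; have := xdist_ge0 m x y; have := xdist_pinfty m x y.
by case: (m x y) => [r| |]//= [] /(_ erefl) [_ []].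
Qed.

Lemma mdist_remote x y : remote_pt y -> x <> y -> m x y = +oo%E.
Proof. by move=> ry xy; apply/xdist_pinfty; split => //; right. Qed.

Lemma fdist_ge0 x y : 0 <= fdist x y.
Proof.
by rewrite /fdist; have := xdist_ge0 m x y; case: (m x y) => //= r; rewrite lee_fin.
Qed.

Lemma fdist_gt0 x y : x <> y -> 0 < fdist x y.
Proof.
move=> xy; rewrite /fdist; have := xdist_ge0 m x y; have := xdist_eq0 m x y.
case: (m x y) => [r| |]//= r0; rewrite lee_fin le_eqVlt => /predU1P[r00|//].
by exfalso; apply: xy; apply/r0; rewrite -r00.
Qed.

Lemma fdist_triangle x y z : ~ remote_pt x -> ~ remote_pt y -> ~ remote_pt z ->
  fdist x z <= fdist x y + fdist y z.
Proof.
by move=> rx ry rz; have := xdist_triangle m x y z; rewrite !mdistE// lee_fin.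
Qed.

Lemma crt_fdist x y z u : crt x y z u = (fdist x y * fdist z u,
  fdist x z * fdist y u, fdist x u * fdist y z).
Proof. by []. Qed.

(* The metric of the structure for which [w] is remote, on the complement of
   [w]. *)
Definition pdist w x y : R := fdist x y / (fdist x w * fdist y w).

Lemma pdistxx w x : pdist w x x = 0.
Proof. by rewrite /pdist fdistxx mul0r. Qed.

Lemma pdistC w x y : pdist w x y = pdist w y x.
Proof. by rewrite /pdist fdistC (mulrC (fdist x w)). Qed.

Lemma pdist_ge0 w x y : 0 <= pdist w x y.
Proof. by rewrite /pdist divr_ge0 ?mulr_ge0 ?fdist_ge0. Qed.

Lemma pdist_gt0 w x y : x <> w -> y <> w -> x <> y -> 0 < pdist w x y.
Proof. by move=> xw yw xy; rewrite /pdist divr_gt0 ?mulr_gt0 ?fdist_gt0. Qed.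

Lemma nbhs_basis x (U : set X) : mobius_basis U -> U x -> nbhs x U.
Proof.
move=> bU Ux; rewrite nbhsE; exists U => //; split => //.
exists [set U] => [_ ->|]; last by rewrite bigcup_set1.
exact: (@finI_from1 _ _ (@mobius_basis R X) id).
Qed.

Lemma nbhs_mball x r : ~ remote_pt x -> 0 < r ->
  nbhs x [set y | ~ remote_pt y /\ fdist x y < r].
Proof.
move=> rx r0; apply: (@filterS _ _ _ [set y | (m x y < r%:E)%E]); last first.
  apply: nbhs_basis; first by exists x, r; split => //; left.
  by rewrite /= (xdist_eq0 m x x).2.
move=> y /= mr; have ry : ~ remote_pt y.
  move=> ry; have [xy|xy] := pselect (x = y); first by rewrite xy in rx.
  by move: mr; rewrite mdist_remote// ltNge leey.
by split => //; move: mr; rewrite mdistE// lte_fin.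
Qed.

Lemma nbhs_remote x p r : remote_pt x -> ~ remote_pt p -> 0 < r ->
  nbhs x [set y | y = x \/ (~ remote_pt y /\ r < fdist p y)].
Proof.
move=> rx rp r0; apply: (@filterS _ _ _ (~` [set y | (m p y <= r%:E)%E])); last first.
  apply: nbhs_basis; first by exists p, r; split => //; right.
  by rewrite /= mdist_remote// => px; rewrite px in rp.
move=> y /= mr; have [yx|yx] := pselect (y = x); [by left|right].
have ry : ~ remote_pt y by move=> /(remote_uniq rx)/esym.
split => //; rewrite ltNge; apply/negP => le; apply: mr.
by rewrite mdistE// lee_fin.
Qed.

(** The cases depend on which of [x] and [w] is remote for the chosen metric, because the value [1]
    of [fdist] at a remote point says nothing about nearness. *)
Lemma nbhs_pdist w x e : x <> w -> 0 < e ->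
  nbhs x [set y | y <> w /\ pdist w x y < e].
Proof.
move=> xw e0; have A0 := fdist_gt0 xw.
have [rx|rx] := pselect (remote_pt x).
  have rw : ~ remote_pt w by move=> /(remote_uniq rx).
  have e0' : 0 < e^-1 by rewrite invr_gt0.
  apply: filterS (nbhs_remote rx rw e0') => y [->|[ry ey]].
    by split => //; rewrite pdistxx.
  have wy : y <> w.
    by move=> yw; move: ey; rewrite yw fdistxx ltNge invr_ge0 ltW.
  split => //; have xy : x <> y by move=> xy; rewrite xy in rx.
  rewrite /pdist !(fdist_remote rx)// !mul1r invf_plt ?posrE// ?fdist_gt0//.
  by rewrite fdistC.
have [rw|rw] := pselect (remote_pt w).
  apply: filterS (nbhs_mball rx e0) => y [ry ey].
  have yw : w <> y by move=> wy; rewrite wy in rw.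
  split; first by move/esym.
  by rewrite /pdist !(fdistC _ w) !(fdist_remote rw)//; [rewrite mulr1 divr1|move/esym].
set A := fdist x w in A0.
(* The first bound keeps [fdist y w] above [A / 2]; given this, the second makes the quotient
   smaller than [e]. *)
pose r := Num.min (A / 2) (e * (A * (A / 2))).
have r0 : 0 < r by rewrite lt_min divr_gt0//= !mulr_gt0// invr_gt0.
apply: filterS (nbhs_mball rx r0) => y [ry]; rewrite lt_min => /andP[y1 y2].
have yA : A / 2 <= fdist y w.
  by have := fdist_triangle rx ry rw; rewrite -/A; lra.
have yw : y <> w.
  move=> yw; move: yA; rewrite yw fdistxx leNgt divr_gt0//.
split => //; rewrite /pdist -/A ltr_pdivrMr ?mulr_gt0 ?fdist_gt0//.
by rewrite (lt_le_trans y2)// ler_pM2l// ler_pM2l.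
Qed.

Lemma nbhs_pdist_oo w o B : o <> w -> 0 < B ->
  nbhs w [set y | y <> w -> B < pdist w o y].
Proof.
move=> ow B0; have A0 := fdist_gt0 ow.
have Bi : 0 < B^-1 by rewrite invr_gt0.
have [rw|rw] := pselect (remote_pt w).
  have ro : ~ remote_pt o by move=> /(remote_uniq rw)/esym.
  apply: filterS (nbhs_remote rw ro B0) => y [->//|[ry ey]] yw.
  by rewrite /pdist !(fdistC _ w) !(fdist_remote rw)//;
    [rewrite mulr1 divr1| move/esym | move/esym].
have [ro|ro] := pselect (remote_pt o).
  apply: filterS (nbhs_mball rw Bi) => y [ry ey] yw.
  have oy : o <> y by move=> oy; rewrite oy in ro.
  rewrite /pdist !(fdist_remote ro)// !mul1r.
  by rewrite invf_pgt ?posrE ?fdist_gt0// fdistC.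
set A := fdist o w in A0.
pose r := Num.min (A / 2) (B^-1 / 2).
have r0 : 0 < r by rewrite lt_min !divr_gt0.
apply: filterS (nbhs_mball rw r0) => y [ry]; rewrite lt_min => /andP[y1 y2] yw.
have q0 := fdist_gt0 yw; rewrite (fdistC w) in y1 y2.
rewrite /pdist -/A ltr_pdivlMr ?mulr_gt0//.
have : A / 2 <= fdist o y by have := fdist_triangle ro ry rw; rewrite -/A; lra.
apply: lt_le_trans.
have -> : A / 2 = B * (A * (B^-1 / 2)) by field; rewrite gt_eqF.
by rewrite ltr_pM2l// ltr_pM2l.
Qed.

Lemma near_pdist w (u : nat -> X) p : u @ \U --> p -> p <> w ->
  (forall n, u n <> w) -> (fun n => pdist w (u n) p) @ \U --> (0 : R).
Proof.
move=> up pw uw; apply/cvgrPdist_lt => e e0.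
have h : \forall n \near \U, u n <> w /\ pdist w p (u n) < e.
  exact: up _ (nbhs_pdist pw e0).
apply: filterS h => n [_].
by rewrite sub0r normrN ger0_norm ?pdist_ge0// pdistC.
Qed.

Lemma near_pdist_oo w o (u : nat -> X) B : u @ \U --> w -> o <> w ->
  (forall n, u n <> w) -> \forall n \near \U, B < pdist w o (u n).
Proof.
move=> uw ow unw; have B0 : 0 < `|B| + 1 by rewrite ltr_wpDl.
have h : \forall n \near \U, u n <> w -> `|B| + 1 < pdist w o (u n).
  exact: uw _ (nbhs_pdist_oo ow B0).
apply: filterS h => n /(_ (unw n)).
by apply: le_lt_trans; rewrite (le_trans (ler_norm _))// lerDl.
Qed.

End PunctureMetric.

(** * Ptolemy's inequality and compactness for the punctured metric *)

Section PunctureTopology.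
Context {R : realType} (X : mobiusSpace R).
Hypotheses (X_compact : compact [set: X]) (X_ptolemy : ptolemy_space X).
Implicit Types x y z u w o : X.

Lemma fdist_ptolemy x y z u :
  fdist x z * fdist y u <= fdist x y * fdist z u + fdist x u * fdist y z.
Proof.
have rhs0 : 0 <= fdist x y * fdist z u + fdist x u * fdist y z.
  by rewrite addr_ge0// mulr_ge0// fdist_ge0.
have [[xz|yu]|/not_orP[xz yu]] := pselect (x = z \/ y = u).
- by rewrite xz fdistxx mul0r; rewrite xz in rhs0.
- by rewrite yu fdistxx mulr0; rewrite yu in rhs0.
have /X_ptolemy : admissible x y z u.
  split=> [[xy yz]|[_ /yu//]|[/xz//]|[yz zu]]; first by apply: xz; rewrite xy.
  by apply: yu; rewrite yz.
by rewrite crt_fdist => -[].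
Qed.

Lemma pdist_triangle w x y z : x <> w -> y <> w -> z <> w ->
  pdist w x z <= pdist w x y + pdist w y z.
Proof.
move=> xw yw zw; have := fdist_ptolemy x y z w.
have x0 := fdist_gt0 xw; have y0 := fdist_gt0 yw; have z0 := fdist_gt0 zw.
rewrite /pdist; set a := fdist x w in x0 *; set b := fdist y w in y0 *.
set c := fdist z w in z0 *; move=> h.
rewrite -(ler_pM2r (mulr_gt0 (mulr_gt0 x0 y0) z0)).
have -> : fdist x z / (a * c) * (a * b * c) = fdist x z * b.
  by field; rewrite !gt_eqF.
have -> : (fdist x y / (a * b) + fdist y z / (b * c)) * (a * b * c) =
  fdist x y * c + a * fdist y z by field; rewrite !gt_eqF.
exact: h.
Qed.

Lemma pdist_ptolemy w x y z u : x <> w -> y <> w -> z <> w -> u <> w ->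
  pdist w x z * pdist w y u <=
  pdist w x y * pdist w z u + pdist w x u * pdist w y z.
Proof.
move=> xw yw zw uw; have h := fdist_ptolemy x y z u.
have x0 := fdist_gt0 xw; have y0 := fdist_gt0 yw; have z0 := fdist_gt0 zw.
have u0 := fdist_gt0 uw.
rewrite /pdist; set a := fdist x w in x0 *; set b := fdist y w in y0 *.
set c := fdist z w in z0 *; set e := fdist u w in u0 *.
rewrite -(ler_pM2r (mulr_gt0 (mulr_gt0 (mulr_gt0 x0 y0) z0) u0)).
have -> : fdist x z / (a * c) * (fdist y u / (b * e)) * (a * b * c * e) =
  fdist x z * fdist y u by field; rewrite !gt_eqF.
have -> : (fdist x y / (a * b) * (fdist z u / (c * e)) +
    fdist x u / (a * e) * (fdist y z / (b * c))) * (a * b * c * e) =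
  fdist x y * fdist z u + fdist x u * fdist y z by field; rewrite !gt_eqF.
exact: h.
Qed.

Lemma pdist_eq0 w x y : x <> w -> y <> w -> pdist w x y = 0 <-> x = y.
Proof.
move=> xw yw; split => [d0|->]; last exact: pdistxx.
have [//|xy] := pselect (x = y).
by have := pdist_gt0 xw yw xy; rewrite d0 ltxx.
Qed.

(** The converse of [nbhs_pdist], by compactness: points outside [U] that approach [x] for [pdist w]
    have a topological limit, which cannot be [w] and is at distance [0] from [x]. *)
Lemma pdist_nbhs w x (U : set X) : x <> w -> nbhs x U ->
  exists2 e, 0 < e & forall y, y <> w -> pdist w x y < e -> U y.
Proof.
move=> xw xU; apply: contrapT => /forall2NP noe.
have hn (n : nat) : exists y, [/\ y <> w, pdist w x y < 4 ^- n & ~ U y].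
  have e0 : (0 : R) < 4 ^- n by rewrite invr_gt0 exprn_gt0.
  have [//|/existsNP[y /not_implyP[yw /not_implyP[xy nU]]]] := noe (4 ^- n).
  by exists y.
have [u hu] := choice hn; have uw n : u n <> w by have [] := hu n.
have [p up] := compact_free_ultra u X_compact.
have pw : p <> w.
  move=> pw; rewrite pw in up.
  have /filter_ex[n] := near_pdist_oo 1 up xw uw.
  have [_ un _] := hu n; rewrite ltNge => /negP; apply; apply/ltW.
  by rewrite (lt_le_trans un)// invf_le1 ?exprn_gt0// exprn_ege1// ler1n.
have px : p = x.
  apply/(pdist_eq0 pw xw)/eqP; rewrite eq_le pdist_ge0 andbT.
  have cst : (fun _ : nat => pdist w p x) @ \U --> pdist w p x by exact: cvg_cst.
  apply: ultra_le cst (ultra_add0 (near_pdist up pw uw) (@cvg_expV4 R)) => n /=.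
  rewrite (le_trans (pdist_triangle pw (uw n) xw))// (pdistC w p) lerD//.
  by have [_ /ltW + _] := hu n; rewrite pdistC.
rewrite px in up; have /filter_ex[n Un] : \forall n \near \U, U (u n) := up _ xU.
by have [_ _] := hu n.
Qed.

Lemma pdist_nbhs_oo w o (U : set X) : o <> w -> nbhs w U ->
  exists B, forall y, y <> w -> B < pdist w o y -> U y.
Proof.
move=> ow wU; apply: contrapT => /forallNP noB.
have hn (n : nat) : exists y, [/\ y <> w, n%:R < pdist w o y & ~ U y].
  have /existsNP[y /not_implyP[yw /not_implyP[xy nU]]] := noB n%:R.
  by exists y.
have [u hu] := choice hn; have uw n : u n <> w by have [] := hu n.
have [p up] := compact_free_ultra u X_compact.
have [pw|pw] := pselect (p = w).
  rewrite pw in up; have /filter_ex[n Un] : \forall n \near \U, U (u n) := up _ wU.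
  by have [_ _] := hu n.
have near1 : \forall n \near \U, pdist w (u n) p < 1.
  by apply: (cvgr_lt _ (near_pdist up pw uw)).
have nearN : \forall n \near \U, pdist w o p + 1 <= n%:R.
  by apply: free_ultrafilter_oo; exact: nbhs_infty_ger.
have [n [/= n1 n2]] := filter_ex (filterI near1 nearN).
have [_ un _] := hu n; have := pdist_triangle ow pw (uw n).
by rewrite (pdistC w p); lra.
Qed.

End PunctureTopology.

(** * Ptolemy circles and lines *)

Section Stereographic.
Context {R : realType}.
Implicit Types (t : R) (p q a : R * R).
Local Notation S1 := (@unit_circle R).

Definition stereo p : R := p.1 / (1 - p.2).

Definition stereoV t : R * R := (2 * t / (1 + t ^+ 2), (t ^+ 2 - 1) / (1 + t ^+ 2)).

Lemma stereo_den t : 0 < 1 + t ^+ 2.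
Proof. by rewrite ltr_pwDl// sqr_ge0. Qed.

Lemma stereoV_circle t : S1 (stereoV t).
Proof. by rewrite /unit_circle/=; field; rewrite gt_eqF// stereo_den. Qed.

Lemma stereoV_pole t : 1 - (stereoV t).2 = 2 / (1 + t ^+ 2).
Proof. by rewrite /=; field; rewrite gt_eqF// stereo_den. Qed.

Lemma stereoVK : cancel stereoV stereo.
Proof.
move=> t; rewrite /stereo stereoV_pole /=; field.
by rewrite gt_eqF// stereo_den.
Qed.

Lemma stereo_sqr p : S1 p -> p.2 <> 1 -> stereo p ^+ 2 = (1 + p.2) / (1 - p.2).
Proof.
case: p => x y; rewrite /unit_circle/stereo/= => xy y1.
have y0 : 1 - y != 0 by rewrite subr_eq0 eq_sym; apply/eqP.
have x2 : x ^+ 2 = (1 - y) * (1 + y).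
  have -> : (1 - y) * (1 + y) = 1 - y ^+ 2 by ring.
  by rewrite -xy addrK.
by rewrite expr_div_n x2; field.
Qed.

Lemma stereoK p : S1 p -> p.2 <> 1 -> stereoV (stereo p) = p.
Proof.
case: p => x y; rewrite /unit_circle/stereo/stereoV/= => xy y1.
have y0 : 1 - y != 0 by rewrite subr_eq0 eq_sym; apply/eqP.
have E : 1 + (x / (1 - y)) ^+ 2 = 2 / (1 - y).
  by have := @stereo_sqr (x, y) xy y1; rewrite /stereo/= => ->; field.
rewrite E; congr pair; first by field.
have -> : (x / (1 - y)) ^+ 2 - 1 = 2 / (1 - y) - 2 by rewrite -E; ring.
by field.
Qed.

Lemma pole_circle p : S1 p -> p.2 = 1 -> p = (0, 1).
Proof.
case: p => x y; rewrite /unit_circle/= => + y1; rewrite y1 expr1n => x2.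
have /eqP : x ^+ 2 = 0 by lra.
by rewrite sqrf_eq0 => /eqP ->.
Qed.

Lemma stereo_continuous p : p.2 <> 1 -> {for p, continuous stereo}.
Proof.
move=> p1; apply: cvgM; first exact: cvg_fst.
apply: cvgV; first by rewrite subr_eq0 eq_sym; apply/eqP.
by apply: cvgB; [exact: cvg_cst | exact: cvg_snd].
Qed.

Lemma stereoV_continuous : continuous stereoV.
Proof.
move=> t; have id2 : (fun s : R => s ^+ 2) @ t --> t ^+ 2 by exact: exprn_continuous.
have den : (fun s : R => (1 + s ^+ 2)^-1) @ t --> (1 + t ^+ 2)^-1.
  apply: cvgV; first by rewrite gt_eqF// stereo_den.
  by apply: cvgD => //; exact: cvg_cst.
have h1 : (fun s : R => 2 * s / (1 + s ^+ 2)) @ t --> 2 * t / (1 + t ^+ 2).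
  by apply: cvgM => //; apply: cvgM; [exact: cvg_cst | exact: cvg_id].
have h2 : (fun s : R => (s ^+ 2 - 1) / (1 + s ^+ 2)) @ t -->
    (t ^+ 2 - 1) / (1 + t ^+ 2).
  by apply: cvgM => //; apply: cvgB => //; exact: cvg_cst.
exact: (cvg_pair h1 h2).
Qed.

Lemma stereoV_oo (V : set (R * R)) : nbhs ((0, 1) : R * R) V ->
  exists N : R, forall t, N < `|t| -> V (stereoV t).
Proof.
move=> /nbhs_ballP[e /= e0 eV]; exists (1 + 2 / e) => t tN; apply: eV.
have e20 : 0 < 2 / e by rewrite divr_gt0.
have t0 : 0 < `|t| by lra.
have te : 2 < e * `|t| by rewrite mulrC -ltr_pdivrMr//; lra.
have t2 : t ^+ 2 = `|t| * `|t| by rewrite -expr2 real_normK ?num_real.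
have D0 := stereo_den t; split; rewrite /ball/=.
  rewrite sub0r normrN normrM normfV [`|1 + _|]gtr0_norm// ltr_pdivrMr//.
  rewrite normrM ger0_norm// (lt_trans (_ : _ < e * `|t| * `|t|))//.
    by rewrite ltr_pM2r.
  by rewrite t2 mulrDr mulr1 mulrA ltrDr.
rewrite -/(stereoV t).2 stereoV_pole ger0_norm ?divr_ge0// ?ltW//.
rewrite ltr_pdivrMr// (lt_trans te)// ltr_pM2l// t2.
have : `|t| * 1 <= `|t| * `|t| by rewrite ler_pM2l//; lra.
lra.
Qed.

(** For [a] on the circle, the rotation taking the pole [(0, 1)] to [a]; it allows projecting from
    any point. *)
Definition rot a p : R * R := (p.1 * a.2 + p.2 * a.1, p.2 * a.2 - p.1 * a.1).

Definition rotV a p : R * R := (p.1 * a.2 - p.2 * a.1, p.1 * a.1 + p.2 * a.2).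

Lemma rotK a : S1 a -> cancel (rot a) (rotV a).
Proof.
rewrite /unit_circle/= => a1 [x y]; rewrite /rot/rotV/=; congr pair.
  by rewrite -[RHS]mulr1 -a1; ring.
by rewrite -[RHS]mulr1 -a1; ring.
Qed.

Lemma rotVK a : S1 a -> cancel (rotV a) (rot a).
Proof.
rewrite /unit_circle/= => a1 [x y]; rewrite /rot/rotV/=; congr pair.
  by rewrite -[RHS]mulr1 -a1; ring.
by rewrite -[RHS]mulr1 -a1; ring.
Qed.

Lemma rot_circle a p : S1 a -> S1 p -> S1 (rot a p).
Proof.
rewrite /unit_circle/rot/= => a1 p1; rewrite -[RHS]mulr1 -{1}p1 -a1; ring.
Qed.

Lemma rotV_circle a p : S1 a -> S1 p -> S1 (rotV a p).
Proof.
rewrite /unit_circle/rotV/= => a1 p1; rewrite -[RHS]mulr1 -{1}p1 -a1; ring.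
Qed.

Lemma rot_pole a : rot a (0, 1) = a.
Proof. by case: a => x y; rewrite /rot/= !mul0r !mul1r add0r subr0. Qed.

Lemma rot_continuous a : continuous (rot a).
Proof.
move=> p; have p1 : (fst : R * R -> R) @ p --> p.1 by exact: cvg_fst.
have p2 : (snd : R * R -> R) @ p --> p.2 by exact: cvg_snd.
have h1 : (fun q : R * R => q.1 * a.2 + q.2 * a.1) @ p --> p.1 * a.2 + p.2 * a.1.
  by apply: cvgD; apply: cvgM => //; exact: cvg_cst.
have h2 : (fun q : R * R => q.2 * a.2 - q.1 * a.1) @ p --> p.2 * a.2 - p.1 * a.1.
  by apply: cvgB; apply: cvgM => //; exact: cvg_cst.
exact: (cvg_pair h1 h2).
Qed.

Lemma rotV_continuous a : continuous (rotV a).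
Proof.
move=> p; have p1 : (fst : R * R -> R) @ p --> p.1 by exact: cvg_fst.
have p2 : (snd : R * R -> R) @ p --> p.2 by exact: cvg_snd.
have h1 : (fun q : R * R => q.1 * a.2 - q.2 * a.1) @ p --> p.1 * a.2 - p.2 * a.1.
  by apply: cvgB; apply: cvgM => //; exact: cvg_cst.
have h2 : (fun q : R * R => q.1 * a.1 + q.2 * a.2) @ p --> p.1 * a.1 + p.2 * a.2.
  by apply: cvgD; apply: cvgM => //; exact: cvg_cst.
exact: (cvg_pair h1 h2).
Qed.

Lemma punctured_circle_param (T : topologicalType) (A : set T) (w : T) :
  homeomorphic_sets A S1 -> A w -> exists (e : R -> T) (tau : T -> R),
  [/\ forall t, A (e t) /\ e t <> w, cancel e tau,
      forall x, A x -> x <> w -> e (tau x) = x,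
      continuous e /\ {within A `\ w, continuous tau} &
      forall U, nbhs w U -> exists N : R, forall t, N < `|t| -> U (e t)].
Proof.
move=> [f [g [fA gA fK gK [fc gc]]]] Aw; pose a := f w.
have Sa : S1 a by exact: fA.
have Srs t : S1 (rot a (stereoV t)) by apply: rot_circle => //; exact: stereoV_circle.
have fKA x : A x -> g (f x) = x by move=> Ax; apply: fK; rewrite inE.
have gKS p : S1 p -> f (g p) = p by move=> Sp; apply: gK; rewrite inE.
pose e t := g (rot a (stereoV t)); pose tau x := stereo (rotV a (f x)).
have fe t : f (e t) = rot a (stereoV t) by exact: gKS.
have gw : g (rot a (0, 1)) = w by rewrite rot_pole fKA.
have gnb p U : S1 p -> nbhs (g p) U -> nbhs p [set q | S1 q -> U (g q)].
  by move=> Sp; move/subspace_continuousP: gc => /(_ p Sp); exact.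
have npole x : A x -> x <> w -> (rotV a (f x)).2 <> 1.
  move=> Ax xw /(pole_circle (rotV_circle Sa (fA _ Ax))) p.
  by apply: xw; rewrite -(fKA _ Ax) -(rotVK Sa (f x)) p.
exists e, tau; split.
- move=> t; split; first exact: gA.
  move=> ew; have /(congr1 (rotV a)) := fe t; rewrite ew -/a (rotK Sa).
  rewrite -{2}(rot_pole a) (rotK Sa) => /(congr1 snd) /= h.
  have := stereoV_pole t; rewrite /= -h subrr => /esym/eqP.
  by rewrite mulf_eq0 invr_eq0 pnatr_eq0/= gt_eqF// stereo_den.
- by move=> t; rewrite /tau fe rotK// stereoVK.
- move=> x Ax xw; rewrite /e /tau stereoK ?rotVK ?fKA//; last exact: npole.
  by apply: rotV_circle => //; exact: fA.
- split.
    move=> t U /= Ue.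
    have c : continuous (rot a \o stereoV).
      by move=> s;
        exact: (continuous_comp (@stereoV_continuous s) (@rot_continuous a _)).
    have h : \forall s \near t, S1 (rot a (stereoV s)) -> U (e s).
      exact: c t _ (gnb _ _ (Srs t) Ue).
    by apply: filterS h => s; apply.
  apply/subspace_continuousP => x [Ax xw] U Utau.
  have h : nbhs (f x) [set p | U (stereo (rotV a p))].
    have c : {for f x, continuous (stereo \o rotV a)}.
      apply: continuous_comp (@rotV_continuous a (f x)) _.
      by apply: stereo_continuous; exact: npole.
    exact: c.
  move/subspace_continuousP: fc => /(_ x Ax _ h) fx.
  have h' : \forall y \near x, A y -> U (tau y) := fx.
  by apply: filterS h' => y hy [Ay _]; exact: hy.
- move=> U wU; rewrite -gw in wU.
  have Sp : S1 (rot a (0, 1)) by rewrite rot_pole.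
  have [N Ne] := stereoV_oo (rot_continuous (gnb _ _ Sp wU)).
  by exists N => t /Ne /=; apply.
Qed.

End Stereographic.

(** * A punctured Ptolemy circle is a line *)

Section CirclesAreLines.
Context {R : realType} (X : mobiusSpace R).
Hypotheses (X_compact : compact [set: X]) (X_ptolemy : ptolemy_space X).
Implicit Types (x y z w o : X) (A : set X) (c q : R -> X).

Definition line_avoiding w c : Prop :=
  (forall t, c t <> w) /\ forall s t, pdist w (c s) (c t) = `|s - t|.

Lemma circle_line A w : ptolemy_circle A -> A w -> exists c,
  [/\ line_avoiding w c, forall t, A (c t) &
      forall x, A x -> x <> w -> exists t, x = c t].
Proof.
move=> [hom ptol] Aw.
have [e [tau [eA eK tauK [ec tauc] eoo]]] := punctured_circle_param hom Aw.
have ew t : e t <> w by have [] := eA t.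
have eAt t : A (e t) by have [] := eA t.
pose D s t := pdist w (e s) (e t).
have DC s t : D s t = D t s by exact: pdistC.
(* A connected subset of the circle avoiding [w] and [e t] has as its image under [tau] an interval
   that misses [t]. *)
have sep (s t u : R) : s < t -> t < u -> separates A w (e t) (e s) (e u).
  move=> st tu [C [Cs CA Cc] Cu].
  have Cw : {within C, continuous tau}.
    apply: continuous_subspaceW tauc => x /CA [Ax xwt]; split => // xw.
    by apply: xwt; left.
  have /connected_intervalP ti := connected_continuous_connected Cc Cw.
  have Ts : (tau @` C) s by exists (e s) => //; exact: eK.
  have Tu : (tau @` C) u by exists (e u) => //; exact: eK.
  have [|x Cx xt] := ti s u Ts Tu t; first by rewrite !ltW.
  have [Ax xwt] := CA _ Cx; apply: xwt; right => /=.
  by rewrite -xt tauK// => xw; apply: (CA _ Cx).2; left.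
have einj (s t : R) : s < t -> e s <> e t.
  by move=> st /(congr1 tau); rewrite !eK => sE; rewrite sE ltxx in st.
have we t : w <> e t by move/esym; exact: ew.
have Dadd (s t u : R) : s < t -> t < u -> D s u = D s t + D t u.
  move=> st tu; have su := lt_trans st tu.
  have : fdist w (e t) * fdist (e s) (e u) =
      fdist w (e s) * fdist (e t) (e u) + fdist w (e u) * fdist (e s) (e t).
    exact: ptol _ _ _ _ Aw (eAt s) (eAt t) (eAt u) (we s) (we t) (we u)
      (einj _ _ st) (einj _ _ su) (einj _ _ tu) (sep _ _ _ st tu).
  rewrite /D /pdist !(fdistC w).
  have s0 := fdist_gt0 (ew s); have t0 := fdist_gt0 (ew t).
  have u0 := fdist_gt0 (ew u).
  set a := fdist (e s) w in s0 *; set b := fdist (e t) w in t0 *.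
  set f := fdist (e u) w in u0 *; set f1 := fdist (e s) (e u).
  move=> h; have -> : f1 = (b * f1) / b by rewrite mulrC mulKf// gt_eqF.
  by rewrite h; field; rewrite !gt_eqF.
pose l t := if 0 <= t then D 0 t else - D 0 t.
have D00 t : D t t = 0 by exact: pdistxx.
have lD s t : s < t -> l t - l s = D s t.
  move=> st; rewrite /l; have [s0|s0] := leP 0 s.
    rewrite (le_trans s0 (ltW st)); move: s0; rewrite le_eqVlt => /predU1P[<-|s0].
      by rewrite D00 subr0.
    by rewrite (Dadd _ _ _ s0 st) addrC addKr.
  rewrite opprK [D 0 s]DC; have [t0|t0] := leP 0 t.
    move: t0; rewrite le_eqVlt => /predU1P[<-|t0]; first by rewrite D00 add0r.
    by rewrite (Dadd _ _ _ s0 t0) addrC.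
  by rewrite (Dadd _ _ _ st t0) [D 0 t]DC addrC addrK.
have lN s t : `|l s - l t| = D s t.
  have [st|ts|->] := ltgtP s t; last by rewrite subrr normr0 D00.
    by rewrite distrC (lD _ _ st) ger0_norm// pdist_ge0.
  by rewrite (lD _ _ ts) ger0_norm ?pdist_ge0// DC.
have lc : continuous l.
  move=> t; apply/cvgrPdist_lt => r r0.
  have h : \forall s \near t, e s <> w /\ pdist w (e t) (e s) < r.
    exact: ec t _ (nbhs_pdist (ew t) r0).
  by apply: filterS h => s [_]; rewrite lN.
(* Both ends of [e] tend to [w], near which the distance from [e 0] exceeds any bound. *)
have lsurj v : exists t, l t = v.
  have B0 : 0 < `|v| + 1 by rewrite ltr_wpDl.
  have [N NB] := eoo _ (nbhs_pdist_oo (ew 0) B0).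
  pose b := `|N| + 1; have b0 : 0 < b by rewrite ltr_wpDl.
  have Nb : N < b by rewrite (le_lt_trans (ler_norm _))// ltrDl.
  have bp : `|v| < l b.
    have := NB b; rewrite gtr0_norm// => /(_ Nb (ew b)) /=.
    by rewrite /l ltW// -/(D 0 b); lra.
  have bm : l (- b) < - `|v|.
    have := NB (- b); rewrite normrN gtr0_norm// => /(_ Nb (ew _)) /=.
    by rewrite /l lt_geF ?oppr_lt0// -/(D 0 (- b)); lra.
  have [||t _ lt] := @IVT R l (- b) b v _ (continuous_subspaceT lc).
  - by lra.
  - have := ler_norm v; have := ler_norm (- v); rewrite normrN => v1 v2.
    by rewrite ge_min le_max; apply/andP; split; apply/orP; [left|right]; lra.
  by exists t.
have [li liE] := choice lsurj.
exists (e \o li); split.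
- by split => [t|s t] /=; [exact: ew | rewrite -/(D _ _) -lN !liE].
- by move=> t; exact: eAt.
- move=> x Ax xw; exists (l (tau x)) => /=; rewrite -[LHS]tauK//; congr e.
  apply/eqP; rewrite -(inj_eq (can_inj eK)); apply/eqP.
  apply/(pdist_eq0 (ew _) (ew _)); rewrite -/(D _ _) -lN liE subrr normr0 //.
Qed.

End CirclesAreLines.

(** * A line closes up to a Ptolemy circle *)

Section LinesAreCircles.
Context {R : realType} (X : mobiusSpace R).
Hypotheses (X_compact : compact [set: X]) (X_ptolemy : ptolemy_space X).
Implicit Types (x y z w o : X) (A : set X) (c q : R -> X).

(* A parametrisation of a circle minus [x], in which the metric with remote
   point [x] is a multiple of the usual distance. *)
Record circle_chart A x q : Prop := CircleChart {
  chart_continuous : continuous q;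
  chart_neq : forall s, q s <> x;
  chart_onto : forall y, A y -> y <> x -> exists s, y = q s;
  chart_in : forall s, A (q s);
  chart_dist : exists (k : R) (m : R -> R), [/\ forall s, 0 < m s,
    forall s, fdist x (q s) = k * m s &
    forall s t, fdist (q s) (q t) = m s * m t * `|s - t|] }.

Lemma chart_inj A x q s t : circle_chart A x q -> q s = q t -> s = t.
Proof.
move=> /chart_dist[k [m [m0 _ mst]]] st; apply/eqP.
have := mst s t; rewrite st fdistxx => /esym/eqP; rewrite !mulf_eq0.
by rewrite (gt_eqF (m0 s)) (gt_eqF (m0 t))/= normr_eq0 subr_eq0.
Qed.

(** In the chart the equality is additivity of lengths of intervals, with [z] between [y] and [u];
    if [z] were not between them, the arc joining [y] to [u] would avoid [x] and [z], against
    separation. *)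
Lemma chart_ptolemy A x q y z u : circle_chart A x q -> A y -> A z -> A u ->
  y <> x -> z <> x -> u <> x -> separates A x z y u ->
  fdist x z * fdist y u = fdist x y * fdist z u + fdist x u * fdist y z.
Proof.
move=> ch Ay Az Au yx zx ux sep.
have [s sy] := chart_onto ch Ay yx; have [t tz] := chart_onto ch Az zx.
have [r ru] := chart_onto ch Au ux.
have arc (a b : R) : a <= b -> ~ (a <= t <= b) ->
    connected (q @` `[a, b]%classic) /\ q @` `[a, b]%classic `<=` A `\` [set x; z].
  move=> ab tab; split.
    apply: connected_continuous_connected; last first.
      by apply: continuous_subspaceT; exact: chart_continuous ch.
    exact/connected_intervalP/interval_is_interval.
  move=> _ [p /= + <-]; rewrite in_itv/= => pab; split; first exact: chart_in ch _.
  move=> [/= qx|/= qz]; first exact: (chart_neq ch qx).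
  by apply: tab; rewrite -(@chart_inj _ _ _ p t ch)// -tz.
have between : s <= t <= r \/ r <= t <= s.
  apply: contrapT => /not_orP[str rts]; apply: sep.
  have [sr|rs] := leP s r.
    have [C CA] := arc s r sr str.
    exists (q @` `[s, r]%classic); [split => //|].
      by exists s; rewrite ?sy//= in_itv/= lexx sr.
    by exists r; rewrite ?ru//= in_itv/= lexx sr.
  have [C CA] := arc r s (ltW rs) rts.
  exists (q @` `[r, s]%classic); [split => //|].
    by exists s; rewrite ?sy//= in_itv/= lexx ltW.
  by exists r; rewrite ?ru//= in_itv/= lexx ltW.
have [k [m [m0 mk mst]]] := chart_dist ch.
rewrite sy tz ru !mk !mst.
have : `|s - r| = `|t - r| + `|s - t|.
  case: between => /andP[h1 h2].
    by rewrite !ler0_norm ?subr_le0//; [ring | exact: le_trans h2].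
  by rewrite !ger0_norm ?subr_ge0//; [ring | exact: le_trans h2].
by move=> ->; ring.
Qed.

Lemma line_avoiding_continuous w c : line_avoiding w c -> continuous c.
Proof.
move=> [cw cl] t U Ut; have [e e0 eU] := pdist_nbhs X_compact X_ptolemy (cw t) Ut.
suff h : \forall s \near t, U (c s) by exact: h.
near=> s; apply: eU => //; rewrite cl; near: s.
exact: (@cvgr_dist_lt _ _ _ _ _ id t).
Unshelve. all: by end_near. Qed.

Lemma fdist_line w c s t : line_avoiding w c ->
  fdist (c s) (c t) = fdist (c s) w * fdist (c t) w * `|s - t|.
Proof.
move=> [cw cl]; rewrite -cl /pdist mulrC divfK// mulf_neq0// gt_eqF// fdist_gt0//.
Qed.

Definition line_closure w c : set X := [set x | x = w \/ exists t, x = c t].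

Lemma line_chart w c : line_avoiding w c -> circle_chart (line_closure w c) w c.
Proof.
move=> cl; have [cw _] := cl; split => //.
- exact: line_avoiding_continuous cl.
- by move=> y [].
- by move=> s; right; exists s.
- exists 1, (fun s => fdist (c s) w); split => [s|s|s t].
  + exact: fdist_gt0.
  + by rewrite mul1r fdistC.
  + exact: fdist_line.
Qed.

(** Inversion at [c a] read on the line, with parameter [0] for [w]. Any point of the closure can
    thus play the point at infinity, in particular the first entry of a quadruple. *)
Lemma line_chart_at w c a : line_avoiding w c ->
  circle_chart (line_closure w c) (c a)
    (fun s => if s == 0 then w else c (a + s^-1)).
Proof.
move=> cl; have [cw cd] := cl; split.
- move=> s U /=; have [->|s0] := eqVneq s 0 => sU.
    have [B BU] := pdist_nbhs_oo X_compact X_ptolemy (cw a) sU.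
    have B0 : 0 < (`|B| + 1)^-1 by rewrite invr_gt0 ltr_wpDl.
    suff h : \forall t \near (0 : R), U (if t == 0 then w else c (a + t^-1)).
      exact: h.
    near=> t; case: eqVneq => [_|t0]; first exact: nbhs_singleton.
    apply: BU => //; rewrite cd opprD addrA subrr sub0r normrN normfV.
    have tB : `|t| < (`|B| + 1)^-1.
      rewrite -normrN -sub0r; near: t.
      exact: (@cvgr_dist_lt _ _ _ _ _ id 0).
    have : `|B| + 1 < `|t|^-1.
      by rewrite -[`|B| + 1]invrK ltf_pV2 ?posrE ?normr_gt0.
    by have := ler_norm B; lra.
  have h : \forall t \near s, U (c (a + t^-1)).
    have cc : {for s, continuous (fun t : R => c (a + t^-1))}.
      apply: (@continuous_comp _ _ _ (fun t : R => a + t^-1) c).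
        by apply: cvgD; [exact: cvg_cst | apply: cvgV].
      exact: line_avoiding_continuous cl _.
    exact: cc.
  have h0 : \forall t \near s, t != 0.
    exact: (@cvgr_neq0 _ _ _ (nbhs s) _ id s cvg_id s0).
  by apply: filterS2 h h0 => t Ut /negPf t0; rewrite /= t0.
- move=> s; case: eqVneq => [_|s0]; first by move/esym; exact: cw.
  move=> /esym e; have := cd a (a + s^-1); rewrite -e pdistxx.
  rewrite opprD addrA subrr sub0r normrN => /esym/eqP.
  by rewrite normr_eq0 invr_eq0 (negPf s0).
- move=> y [->|[t ->]] tn; first by exists 0; rewrite eqxx.
  exists (t - a)^-1; rewrite invr_eq0 subr_eq0 invrK.
  by case: eqVneq => [ta|_]; [rewrite ta in tn | congr c; ring].
- by move=> s; case: eqVneq => [_|_]; [left | right; exists (a + s^-1)].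
- exists (fdist (c a) w), (fun s => if s == 0 then 1 else fdist (c (a + s^-1)) w / `|s|).
  split => [s|s|s t].
  + by case: eqVneq => // s0; rewrite divr_gt0 ?fdist_gt0 ?normr_gt0.
  + case: eqVneq => [_|s0]; first by rewrite mulr1.
    by rewrite (fdist_line _ _ cl) opprD addrA subrr sub0r normrN normfV mulrA.
  + case: (eqVneq s 0) => [->|s0]; case: (eqVneq t 0) => [->|t0].
    * by rewrite fdistxx subrr normr0 mulr0.
    * by rewrite sub0r normrN mul1r divfK ?normr_eq0// fdistC.
    * by rewrite subr0 mulr1 divfK ?normr_eq0.
    * rewrite (fdist_line _ _ cl).
      have -> : a + s^-1 - (a + t^-1) = (t - s) / (s * t) by field; rewrite s0 t0.
      rewrite normrM normfV normrM (distrC t).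
      by field; rewrite !normr_eq0 s0 t0.
Unshelve. all: by end_near. Qed.

Lemma line_homeomorphic w c : line_avoiding w c ->
  homeomorphic_sets (line_closure w c) (@unit_circle R).
Proof.
move=> cl; have [cw cd] := cl.
have cinj s t : c s = c t -> s = t.
  move=> st; apply/eqP; rewrite -subr_eq0 -normr_eq0 -cd st pdistxx//.
pose ci x := xget 0 [set t | c t = x].
have ciK t : ci (c t) = t.
  apply: cinj; rewrite /ci.
  by apply: (@xgetPex R 0 [set s | c s = c t]); exists t.
pose f x : R * R := if pselect (x = w) then (0, 1) else stereoV (ci x).
pose g p : X := if p.2 == 1 then w else c (stereo p).
have fw : f w = (0, 1) by rewrite /f; case: pselect.
have fc t : f (c t) = stereoV t.
  by rewrite /f; case: pselect => [/(cw t)//|n]; rewrite ciK.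
have Sp : @unit_circle R (0, 1).
  by rewrite /unit_circle/= expr0n expr1n add0r.
have gV t : g (stereoV t) = c t.
  rewrite /g; case: eqVneq => [p1|_]; last by rewrite stereoVK.
  have := stereoV_pole t; rewrite p1 subrr => /esym/eqP.
  by rewrite mulf_eq0 invr_eq0 pnatr_eq0/= gt_eqF// stereo_den.
exists f, g; split.
- by move=> x [->|[t ->]]; rewrite ?fw ?fc//; exact: stereoV_circle.
- move=> p _; rewrite /g; case: eqVneq => _; [by left | right].
  by exists (stereo p).
- move=> x; rewrite inE => -[->|[t ->]]; last by rewrite fc gV.
  by rewrite fw /g eqxx.
- move=> p; rewrite inE => p1; rewrite /g; case: eqVneq => [/(pole_circle p1) ->//|pn].
  by rewrite fc stereoK//; apply/eqP.
split.
  apply/subspace_continuousP => x [->|[t ->]] U.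
    move=> fU; have {}fU : nbhs ((0, 1) : R * R) U by rewrite -fw.
    have [N NU] := stereoV_oo fU.
    have Uw : U (f w) by rewrite fw; exact: nbhs_singleton fU.
    have N0 : 0 < `|N| + 1 by rewrite ltr_wpDl.
    apply: filterS (nbhs_pdist_oo (cw 0) N0) => y /= yw [->|[s ys]].
      exact: Uw.
    suff : U (f (c s)) by rewrite -ys.
    rewrite fc; apply: NU; have := yw; rewrite ys => /(_ (cw s)).
    by rewrite cd sub0r normrN; have := ler_norm N; lra.
  move=> fU; have {}fU : nbhs (stereoV t) U by rewrite -fc.
  have /nbhs_ballP[e /= e0 eU] := stereoV_continuous fU.
  apply: filterS (nbhs_pdist (cw t) e0) => y /= [yw ye] [//|[s ys]].
  suff : U (f (c s)) by rewrite -ys.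
  by rewrite fc; apply: eU; rewrite /ball/= -cd -ys.
apply/subspace_continuousP => p p1 U gU.
have {gU} : nbhs (g p) U := gU; rewrite {1}/g.
have [p2|pn] := eqVneq p.2 1 => [wU|pU].
  rewrite (pole_circle p1 p2).
  have [B BU] := pdist_nbhs_oo X_compact X_ptolemy (cw 0) wU.
  (* The bound by [1] gives [b > 0]; then [(1 + b) / (1 - b)], the square of the stereographic
     parameter, exceeds the inverse of the second bound. *)
  pose e : R := Num.min 1 ((`|B| + 1) ^- 2).
  have B0 : 0 < `|B| + 1 by rewrite ltr_wpDl.
  have e0 : 0 < e by rewrite /e lt_min ltr01 invr_gt0 exprn_gt0.
  apply/nbhs_ballP; exists e => //= -[a b] [/= _ be] ab1.
  suff : U (g (a, b)) by [].
  rewrite /g /=; case: eqVneq => [_|b1]; first exact: nbhs_singleton.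
  apply: BU => //; rewrite cd sub0r normrN (le_lt_trans (ler_norm _))//.
  rewrite (@lt_le_trans _ _ (`|B| + 1))// ?ltrDl//.
  have : `|1 - b| < Num.min 1 ((`|B| + 1) ^- 2) by exact: be.
  rewrite lt_min => /andP[be1 be2].
  have b0 : 0 < b by move: be1; rewrite ltr_norml => /andP[]; lra.
  have b1' : b <> 1 by exact/eqP.
  have bl1 : 0 < 1 - b.
    rewrite subr_gt0 lt_neqAle b1/=; have : 0 <= a ^+ 2 by exact: sqr_ge0.
    move: ab1; rewrite /unit_circle/= => ab ?.
    by rewrite -(@ler_sqr R b 1) ?nnegrE ?(ltW b0)// expr1n; lra.
  rewrite -ler_sqr ?nnegrE ?normr_ge0 ?(ltW B0)// real_normK ?num_real//.
  rewrite (@stereo_sqr _ (a, b) ab1 b1')/= ler_pdivlMr//.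
  apply: le_trans (_ : (`|B| + 1) ^+ 2 * (`|B| + 1) ^- 2 <= _).
    by rewrite ler_pM2l ?exprn_gt0//; move: be2; rewrite gtr0_norm// => /ltW.
  by rewrite mulfV ?expf_neq0 ?gt_eqF//; lra.
have h : \forall q \near p, U (c (stereo q)).
  have cc : {for p, continuous (c \o stereo)}.
    apply: continuous_comp; first by apply: stereo_continuous; exact/eqP.
    exact: line_avoiding_continuous cl _.
  exact: cc.
have h0 : \forall q \near p, q.2 != 1.
  have q2 : (fun q : R * R => q.2 - 1) @ p --> p.2 - 1.
    by apply: cvgB; [exact: cvg_snd | exact: cvg_cst].
  have pn' : p.2 - 1 != 0 by rewrite subr_eq0.
  have h1 : \forall q \near p, q.2 - 1 != 0 by exact: cvgr_neq0 q2 pn'.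
  apply: filterS h1 => q.
  by rewrite subr_eq0.
apply: filterS2 h h0 => q Uq /negPf q1 _.
suff : U (g q) by [].
by rewrite /g q1.
Qed.

Lemma line_circle w c : line_avoiding w c -> ptolemy_circle (line_closure w c).
Proof.
move=> cl; split; first exact: line_homeomorphic.
move=> x y z u Ax Ay Az Au xy xz xu _ _ _ sep.
rewrite crt_fdist; have [q ch] : exists q, circle_chart (line_closure w c) x q.
  case: Ax => [->|[a ->]]; first by exists c; exact: line_chart.
  by eexists; exact: line_chart_at.
by apply: (chart_ptolemy ch) => //; exact: nesym.
Qed.

End LinesAreCircles.

(** * Moebius maps and similarities *)

Section MobiusMaps.
Context {R : realType} (X : mobiusSpace R).
Implicit Types (x y z u v w o : X) (f g : X -> X).

(* The ratio [pdist (f w) (f x) (f y) / pdist w x y] is symmetric in the three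
   points other than [w] of a quadruple, hence constant. *)
Lemma mobius_ratio (A : set X) f w x y z : mobius_on A f -> A w -> A x -> A y ->
  A z -> x <> w -> y <> w -> z <> w -> x <> y -> x <> z -> y <> z ->
  pdist (f w) (f x) (f y) * pdist w x z = pdist (f w) (f x) (f z) * pdist w x y.
Proof.
move=> [finj fm] Aw Ax Ay Az xw yw zw xy xz yz.
have fi p q : A p -> A q -> p <> q -> f p <> f q.
  by move=> Ap Aq pq fpq; apply: pq; apply: finj fpq; rewrite inE.
have adm : admissible x y z w by split => -[].
have [k k0 []] := fm _ _ _ _ Ax Ay Az Aw adm.
rewrite -!/(fdist _ _) /pdist => e1 e2 _.
have x0 := fdist_gt0 xw; have y0 := fdist_gt0 yw; have z0 := fdist_gt0 zw.
have fx0 := fdist_gt0 (fi _ _ Ax Aw xw); have fy0 := fdist_gt0 (fi _ _ Ay Aw yw).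
have fz0 := fdist_gt0 (fi _ _ Az Aw zw).
have E1 : fdist x y = k * (fdist (f x) (f y) * fdist (f z) (f w)) / fdist z w.
  by rewrite -e1 mulfK// gt_eqF.
have E2 : fdist x z = k * (fdist (f x) (f z) * fdist (f y) (f w)) / fdist y w.
  by rewrite -e2 mulfK// gt_eqF.
by rewrite E1 E2; field; rewrite !gt_eqF.
Qed.

(** The factor found on one pair [o], [p] spreads by [mobius_ratio] to the pairs containing [o],
    then to all. If [A] has no two points besides [w], any factor will do. *)
Lemma mobius_similarity (A : set X) f w : mobius_on A f -> A w ->
  exists2 k : R, 0 < k & forall x y, A x -> A y -> x <> w -> y <> w ->
    pdist (f w) (f x) (f y) = k * pdist w x y.
Proof.
move=> fm Aw; have [finj _] := fm.
have fi p q : A p -> A q -> p <> q -> f p <> f q.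
  by move=> Ap Aq pq fpq; apply: pq; apply: finj fpq; rewrite inE.
have [[ o [p [Ao Ap ow [pw op]]]]|no] := pselect (exists o p,
    [/\ A o, A p, o <> w & p <> w /\ o <> p]); last first.
  exists 1 => // x y Ax Ay xw yw; have [->|xy] := pselect (x = y).
    by rewrite !pdistxx mulr0.
  by exfalso; apply: no; exists x, y.
have D0 : 0 < pdist w o p by exact: pdist_gt0.
exists (pdist (f w) (f o) (f p) / pdist w o p).
  by rewrite divr_gt0// pdist_gt0//; exact: fi.
set k := _ / _.
have ko z : A z -> z <> w -> z <> o -> pdist (f w) (f o) (f z) = k * pdist w o z.
  move=> Az zw zo; have [->|zp] := pselect (z = p).
    by rewrite /k divfK// gt_eqF.
  have := mobius_ratio fm Aw Ao Az Ap ow zw pw (nesym zo) op zp.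
  by move=> h; rewrite /k mulrAC -h mulfK// gt_eqF.
move=> x y Ax Ay xw yw; have [->|xy] := pselect (x = y).
  by rewrite !pdistxx mulr0.
have [xo|xo] := pselect (x = o); first by rewrite xo ko// -xo; exact: nesym.
have [yo|yo] := pselect (y = o).
  by rewrite yo pdistC ko// (pdistC w).
have := mobius_ratio fm Aw Ax Ay Ao xw yw ow xy xo yo.
rewrite [pdist (f w) (f x) (f o)]pdistC ko// [pdist w x o]pdistC => h.
apply: (@mulIf _ (pdist w o x)); last by rewrite h; ring.
by rewrite gt_eqF// pdist_gt0//; exact: nesym.
Qed.

Lemma conformal_mobius f (m : X -> R) : injective f -> (forall x, 0 < m x) ->
  (forall x y, fdist (f x) (f y) = m x * m y * fdist x y) ->
  mobius_on [set: X] f.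
Proof.
move=> fi m0 fm; split; first by move=> x y _ _; exact: fi.
move=> x y z u _ _ _ _ _; rewrite !crt_fdist !fm.
exists (m x * m y * m z * m u)^-1.
  by rewrite invr_eq0 !mulf_neq0// gt_eqF.
by split; field; rewrite !gt_eqF.
Qed.

Lemma similarity_mobius f w k : bijective f -> 0 < k ->
  (forall x y, x <> w -> y <> w -> pdist (f w) (f x) (f y) = k * pdist w x y) ->
  mobius_automorphism f.
Proof.
move=> fb k0 fd; have fi := bij_inj fb; split => //.
have fw x : x <> w -> f x <> f w by move=> xw /fi.
pose s := Num.sqrt k; have s0 : 0 < s by rewrite sqrtr_gt0.
have ss : k = s * s by rewrite -expr2 sqr_sqrtr// ltW.
(* The conformal factor of [f] for [fdist]: once [m w = s^-1] is chosen, the pairs [x], [w] force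
   the other values, and [s * s = k] makes the remaining pairs fit. *)
pose m x := if pselect (x = w) then s^-1 else s * fdist (f x) (f w) / fdist x w.
have mw : m w = s^-1 by rewrite /m; case: pselect.
have mx x : x <> w -> m x = s * fdist (f x) (f w) / fdist x w.
  by rewrite /m; case: pselect.
have main x y : x <> w -> fdist (f x) (f y) = m x * m y * fdist x y.
  move=> xw; have x0 := fdist_gt0 xw; have fx0 := fdist_gt0 (fw _ xw).
  have [->|yw] := pselect (y = w).
    by rewrite mw mx//; field; rewrite !gt_eqF.
  have y0 := fdist_gt0 yw; have fy0 := fdist_gt0 (fw _ yw).
  have := fd x y xw yw; rewrite /pdist !mx// ss => h.
  have -> : fdist (f x) (f y) = fdist (f x) (f y) /
      (fdist (f x) (f w) * fdist (f y) (f w)) *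
      (fdist (f x) (f w) * fdist (f y) (f w)).
    by rewrite divfK// mulf_neq0// gt_eqF.
  by rewrite h; field; rewrite !gt_eqF.
apply: (@conformal_mobius f m) => // [x|x y].
  have [->|xw] := pselect (x = w); first by rewrite mw invr_gt0.
  by rewrite mx// divr_gt0 ?mulr_gt0// fdist_gt0//; exact: fw.
have [xw|xw] := pselect (x = w); last exact: main.
have [yw|yw] := pselect (y = w).
  by rewrite xw yw !fdistxx mulr0.
by rewrite fdistC main// (mulrC (m x)) (fdistC x).
Qed.

Lemma mobius_on_comp (A : set X) f g : mobius_on A f -> mobius_on [set: X] g ->
  mobius_on A (g \o f).
Proof.
move=> [fi fm] [gi gm]; have gi' x y : g x = g y -> x = y.
  by move=> gxy; apply: gi gxy; rewrite inE.
have fi' x y : A x -> A y -> f x = f y -> x = y.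
  by move=> Ax Ay fxy; apply: fi fxy; rewrite inE.
split; first by move=> x y /set_mem Ax /set_mem Ay /= /gi' /(fi' _ _ Ax Ay).
move=> x y z u Ax Ay Az Au adm; have [a1 a2 a3 a4] := adm.
apply: proj_eq_trans (fm _ _ _ _ Ax Ay Az Au adm); apply: gm => //; split.
- by move=> [/(fi' _ _ Ax Ay) ? /(fi' _ _ Ay Az) ?]; apply: a1.
- by move=> [/(fi' _ _ Ax Ay) ? /(fi' _ _ Ay Au) ?]; apply: a2.
- by move=> [/(fi' _ _ Ax Az) ? /(fi' _ _ Az Au) ?]; apply: a3.
- by move=> [/(fi' _ _ Ay Az) ? /(fi' _ _ Az Au) ?]; apply: a4.
Qed.

Lemma mobius_automorphism_comp f g : mobius_automorphism f ->
  mobius_automorphism g -> mobius_automorphism (g \o f).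
Proof.
move=> [fb fm] [gb gm]; split; first exact: bij_comp.
exact: mobius_on_comp.
Qed.

(** The usual inversion of a metric at [o], up to a constant. *)
Lemma pdist_change w o x y : x <> w -> y <> w -> x <> o -> y <> o -> o <> w ->
  pdist o x y = pdist w x y / (pdist w x o * pdist w y o * fdist o w ^+ 2).
Proof.
move=> xw yw xo yo ow; rewrite /pdist.
by field; rewrite !gt_eqF ?fdist_gt0.
Qed.

Lemma pdist_change_remote w o x : x <> w -> x <> o -> o <> w ->
  pdist o x w = 1 / (pdist w x o * fdist o w ^+ 2).
Proof.
move=> xw xo ow; rewrite /pdist (fdistC w o).
by field; rewrite !gt_eqF ?fdist_gt0.
Qed.

Lemma sphere_relE w o x y : x <> w -> y <> w -> x <> o -> y <> o -> o <> w ->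
  sphere_rel w o x y <-> pdist w y o = pdist w x o.
Proof.
move=> xw yw xo yo ow.
have x0 := fdist_gt0 xw; have y0 := fdist_gt0 yw; have o0 := fdist_gt0 ow.
have xo0 := fdist_gt0 xo; have yo0 := fdist_gt0 yo.
have E : fdist w x * fdist y o = fdist w y * fdist x o <->
    pdist w y o = pdist w x o.
  rewrite /pdist !(fdistC w); split => h.
    have -> : fdist y o = (fdist x w * fdist y o) / fdist x w.
      by rewrite mulrC mulKf// gt_eqF.
    by rewrite h; field; rewrite !gt_eqF.
  have -> : fdist y o = fdist y o / (fdist y w * fdist o w) * (fdist y w * fdist o w).
    by rewrite divfK// mulf_neq0// gt_eqF.
  by rewrite h; field; rewrite !gt_eqF.
rewrite -E /sphere_rel crt_fdist; split.
  by move=> [t [k k0 [e1 e2 _]]]; apply: (mulfI k0); rewrite -e1 -e2.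
move=> e; have a0 : 0 < fdist w x * fdist y o.
  by rewrite mulr_gt0// fdistC.
exists ((fdist w x * fdist y o)^-1 * (fdist w o * fdist x y)).
exists (fdist w x * fdist y o)^-1; first by rewrite invr_eq0 gt_eqF.
by split => //; rewrite -?e mulVf// gt_eqF.
Qed.

Definition psphere w o (r : R) : set X :=
  [set y | [/\ y <> w, y <> o & pdist w y o = r]].

Lemma psphere_between w o x : o <> w -> x <> w -> x <> o ->
  sphere_between w o (psphere w o (pdist w x o)).
Proof.
move=> ow xw xo; exists x; split => //; apply/seteqP; split => y /= [yw yo e].
  by split => //; apply/sphere_relE.
by split => //; apply/sphere_relE.
Qed.

Section SpaceInversion.
Variables (w o : X) (r : R) (phi : X -> X).
Hypotheses (ow : o <> w) (r0 : 0 < r)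
  (sphere_ne : exists x, [/\ x <> w, x <> o & pdist w x o = r])
  (phiP : space_inversion w o (psphere w o r) phi).

Lemma space_inversion_neq x : x <> w -> x <> o -> phi x <> w /\ phi x <> o.
Proof.
have [[_ phiK] _ pw _ _] := phiP => xw xo; split => px.
  by apply: xo; rewrite -(phiK x) px.
by apply: xw; rewrite -(phiK x) px -pw phiK.
Qed.

(** As [phi] exchanges [w] and [o], it is a similarity from [pdist w] to [pdist o]. Expressing the
    latter through the former gives the formulas with an unknown constant [K], and invariance of the
    sphere forces [K = r ^+ 2]. *)
Lemma space_inversion_dist : (forall x, x <> w -> x <> o ->
    pdist w (phi x) o = r ^+ 2 / pdist w x o) /\
  (forall x y, x <> w -> x <> o -> y <> w -> y <> o ->
    pdist w (phi x) (phi y) = r ^+ 2 * pdist w x y / (pdist w x o * pdist w y o)).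
Proof.
have [[[_ phim] phiK] _ pw pS _] := phiP; have po : phi o = w by rewrite -pw phiK.
have [k k0 kd] := mobius_similarity phim (I : setT w).
pose K := (k * fdist o w ^+ 2)^-1.
have q0 : 0 < fdist o w by exact: fdist_gt0.
have hK x : x <> w -> x <> o -> pdist w (phi x) o = K / pdist w x o.
  move=> xw xo; have [pxw pxo] := space_inversion_neq xw xo.
  have := kd x o I I xw ow; rewrite pw po pdist_change_remote// => h.
  have a0 := pdist_gt0 pxw ow pxo; have b0 := pdist_gt0 xw ow xo.
  have -> : pdist w (phi x) o =
      (1 / (pdist w (phi x) o * fdist o w ^+ 2))^-1 / fdist o w ^+ 2.
    by field; rewrite !gt_eqF.
  by rewrite h /K; field; rewrite !gt_eqF.
have Kr : K = r ^+ 2.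
  have [x [xw xo xr]] := sphere_ne.
  have [_ _] : psphere w o r (phi x) by rewrite -pS; exists x.
  by rewrite hK// xr => h; rewrite expr2 -{1}h divfK// gt_eqF.
split => [x xw xo|x y xw xo yw yo]; first by rewrite hK// Kr.
have [pxw pxo] := space_inversion_neq xw xo.
have [pyw pyo] := space_inversion_neq yw yo.
have := kd x y I I xw yw; rewrite pw (pdist_change pxw pyw pxo pyo ow).
rewrite !hK// => h.
have x0 := pdist_gt0 xw ow xo; have y0 := pdist_gt0 yw ow yo.
have K0 : 0 < K by rewrite invr_gt0 mulr_gt0// exprn_gt0.
have -> : pdist w (phi x) (phi y) = pdist w (phi x) (phi y) /
    (K / pdist w x o * (K / pdist w y o) * fdist o w ^+ 2) *
    (K / pdist w x o * (K / pdist w y o) * fdist o w ^+ 2).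
  rewrite divfK// gt_eqF// mulr_gt0 ?exprn_gt0//.
  by rewrite mulr_gt0// divr_gt0.
rewrite h -Kr /K; field; rewrite !gt_eqF//.
Qed.

End SpaceInversion.

End MobiusMaps.

(** * The complement of a point as an inversive space *)

Section PuncturedSpace.
Context {R : realType} (X : mobiusSpace R).
Hypotheses (X_compact : compact [set: X]) (X_ptolemy : ptolemy_space X)
  (X_inversions : forall (w o : X) (S : set X), w <> o -> sphere_between w o S ->
     exists! phi : X -> X, space_inversion w o S phi).
Variables (A : set X) (w : X).
Hypotheses (A_circle : ptolemy_circle A) (Aw : A w).

Definition punctured : Type := {x : X | x <> w}.
Implicit Types (o p q : punctured) (v : punctured -> punctured).

Lemma punctured_neq p : sval p <> w. Proof. exact: (svalP p). Qed.
Arguments punctured_neq : clear implicits.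

Definition punctured_dist p q : R := pdist w (sval p) (sval q).
Local Notation d := punctured_dist.

Lemma punctured_inj p q : sval p = sval q -> p = q.
Proof.
case: p q => [x xw] [y yw] /= xy; subst y; congr exist; exact: Prop_irrelevance.
Qed.

Lemma punctured_line (c : R -> punctured) : isometric_line d c ->
  line_avoiding w (fun t => sval (c t)).
Proof. by move=> cl; split => [t|s t]; [exact: (svalP (c t)) | exact: cl]. Qed.

(** [phi] takes [o] out of the punctured space, to [w]; the fallback [o] is the junk value that
    [inversion] prescribes. *)
Definition inv_restrict (phi : X -> X) o p : punctured :=
  match pselect (phi (sval p) <> w) with
  | left h => exist _ (phi (sval p)) h
  | right _ => o
  end.

Lemma inv_restrictE phi o p : phi (sval p) <> w ->
  sval (inv_restrict phi o p) = phi (sval p).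
Proof. by rewrite /inv_restrict; case: pselect. Qed.

Lemma inv_restrict_center phi o : phi (sval o) = w -> inv_restrict phi o o = o.
Proof. by rewrite /inv_restrict; case: pselect. Qed.

Lemma svalN p q : p <> q -> sval p <> sval q.
Proof. by move=> pq /punctured_inj. Qed.

Lemma inv_restrict_inversion phi o r : 0 < r -> (exists p, d p o = r) ->
  space_inversion w (sval o) (psphere w (sval o) r) phi ->
  inversion d o r (inv_restrict phi o).
Proof.
move=> r0 [p0 p0r] phiP; have [[_ phiK] phin pw _ pA] := phiP.
have ow := svalP o.
have po : phi (sval o) = w by rewrite -pw phiK.
have ne : exists x, [/\ x <> w, x <> sval o & pdist w x (sval o) = r].
  exists (sval p0); split => //; first exact: (svalP p0).
  by move=> e; move: p0r r0; rewrite /d e pdistxx => <-; rewrite ltxx.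
have [dc dd] := space_inversion_dist ow r0 ne phiP.
have neq p : p <> o -> phi (sval p) <> w /\ phi (sval p) <> sval o.
  by move=> /svalN; exact: space_inversion_neq phiP _ (svalP p).
have rE p : p <> o -> sval (inv_restrict phi o p) = phi (sval p).
  by move=> /neq[h _]; exact: inv_restrictE.
have ro := inv_restrict_center po.
have rd p q : p <> o -> q <> o -> d (inv_restrict phi o p) (inv_restrict phi o q) =
    r ^+ 2 * d p q / (d p o * d q o).
  move=> po' qo; rewrite /d !rE//.
  by apply: dd; (exact: svalN || exact: punctured_neq).
have rdc p : p <> o -> d (inv_restrict phi o p) o = r ^+ 2 / d p o.
  move=> po'; rewrite /d rE//.
  by apply: dc; [exact: punctured_neq | exact: svalN].
split => //.
- move=> p; have [->|pn] := pselect (p = o); first by rewrite !ro.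
  apply: punctured_inj; rewrite rE; first by rewrite rE// phiK.
  by move=> /(congr1 sval); rewrite rE//; have [] := neq _ pn.
- by move=> p pn /(congr1 sval); rewrite rE//; exact: phin.
- move=> c cl c0 t.
  have [->|t0] := eqVneq t 0; first by rewrite invr0 mulr0 oppr0 c0 ro.
  have cn s : s != 0 -> c s <> o.
    move=> s0 e; have := cl s 0; rewrite c0 e subr0 /d pdistxx => /esym/eqP.
    by rewrite normr_eq0 (negPf s0).
  pose B := line_closure w (fun t => sval (c t)).
  have Bc : ptolemy_circle B by apply: line_circle => //; exact: punctured_line.
  have pB : phi @` B = B.
    by apply: pA => //; [left | right; exists 0; rewrite c0].
  (* [phi] preserves the circle that closes the line, and the distance to [o] determines the new
     parameter up to sign. *)
  have onB s : s != 0 -> exists2 s', inv_restrict phi o (c s) = c s' &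
      `|s'| = r ^+ 2 / `|s|.
    move=> s0; have : B (phi (sval (c s))).
      by rewrite -pB; exists (sval (c s)) => //; right; exists s.
    have [n1 _] := neq _ (cn s s0).
    move=> [/n1//|[s' s'E]]; exists s'; first by apply: punctured_inj; rewrite rE//; exact: cn.
    have := rdc _ (cn s s0); have -> : inv_restrict phi o (c s) = c s'.
      by apply: punctured_inj; rewrite rE//; exact: cn.
    by rewrite -c0 !cl !subr0.
  have rn0 : r != 0 by rewrite gt_eqF.
  (* Absence of fixed points settles the sign at [c r]; the distance to [c r] then settles it for
     every [t]. *)
  have cr : inv_restrict phi o (c r) = c (- r).
    have [s sE] := onB r rn0; rewrite (gtr0_norm r0) expr2 mulfK// => sr.
    have [s0|s0] := leP 0 s.
      move: sr sE; rewrite ger0_norm// => -> /(congr1 sval).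
      rewrite rE; last exact: cn.
      by move=> e; case: (phin _ e).
    by rewrite sE; congr c; rewrite -sr ltr0_norm// opprK.
  have [s sE st] := onB t t0.
  have h : `|s + r| = r ^+ 2 * `|t - r| / (`|t| * r).
    have := rd _ _ (cn t t0) (cn r rn0).
    by rewrite sE cr -c0 !cl !subr0 opprK (gtr0_norm r0).
  rewrite sE; congr c.
  have t0' : `|t| != 0 by rewrite normr_eq0.
  have h2 : `|(s + r) * t| = `|r * (t - r)|.
    by rewrite !normrM (gtr0_norm r0) h; field; rewrite t0' rn0.
  have h3 : `|s| * `|t| = r ^+ 2 by rewrite st divfK.
  have /eqP := h3; rewrite -normrM -{1}[r ^+ 2]ger0_norm ?sqr_ge0// eqr_norm2.
  case/orP => /eqP stE; last first.
    by rewrite -mulNr -stE mulfK.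
  exfalso; move: h2 => /eqP.
  rewrite eqr_norm2 mulrDl stE => /orP[] /eqP e.
    have : r * r = 0 by move: e; rewrite expr2 mulrBr; lra.
    by move/eqP; rewrite mulf_eq0 (negPf rn0).
  have : r * t = 0 by move: e; rewrite expr2 mulrBr; lra.
  by move/eqP; rewrite mulf_eq0 (negPf rn0) (negPf t0).
Qed.

Definition inv_extend v o (x : X) : X :=
  match pselect (x <> w) with
  | left h => let p := exist _ x h in if pselect (p = o) then w else sval (v p)
  | right _ => sval o
  end.

Lemma inv_extend_w v o : inv_extend v o w = sval o.
Proof. by rewrite /inv_extend; case: pselect. Qed.

Lemma inv_extendE v o p : inv_extend v o (sval p) = if pselect (p = o) then w else sval (v p).
Proof.
rewrite /inv_extend; case: pselect => [h|/(_ (svalP p))//].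
by have -> : exist _ (sval p) h = p by exact: punctured_inj.
Qed.

Lemma inv_extend_o v o : inv_extend v o (sval o) = w.
Proof. by rewrite inv_extendE; case: pselect. Qed.

Lemma inv_extend_neq v o p : p <> o -> inv_extend v o (sval p) = sval (v p).
Proof. by rewrite inv_extendE; case: pselect. Qed.

Lemma punctured_ind o (P : X -> Prop) : P w -> P (sval o) ->
  (forall p, p <> o -> P (sval p)) -> forall x, P x.
Proof.
move=> Pw Po Pp x; have [->//|xw] := pselect (x = w).
have [xo|xo] := pselect (exist _ x xw = o); first by rewrite -xo in Po.
exact: Pp xo.
Qed.

(** Uniqueness in (I) is about maps of [X], so inversions of the punctured space have to be extended
    to use it. A circle through [w] and [o] is preserved because, without [w], it is a line through
    [o]. *)
Lemma inv_extend_inversion v o r : 0 < r -> inversion d o r v ->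
  space_inversion w (sval o) (psphere w (sval o) r) (inv_extend v o).
Proof.
move=> r0 iv; have ow := svalP o; set f := inv_extend v o.
have fw : f w = sval o := inv_extend_w v o.
have fo : f (sval o) = w := inv_extend_o v o.
have fp p : p <> o -> f (sval p) = sval (v p) := @inv_extend_neq v o p.
have vo p : p <> o -> v p <> o.
  by move=> + vp; apply; rewrite -(invK iv p) vp (inv_center iv).
have fK : involutive f.
  elim/(@punctured_ind o) => [||p po]; rewrite ?fw ?fo//.
  by rewrite fp// fp ?(invK iv)//; exact: vo.
have pos p : p <> o -> 0 < pdist w (sval p) (sval o).
  by move=> po; apply: pdist_gt0 => //; [exact: (svalP p) | exact: svalN].
have vd0 p : p <> o -> pdist w (sval (v p)) (sval o) = r ^+ 2 / pdist w (sval p) (sval o).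
  by move=> po; exact: (inv_distc iv po).
have vd p q : p <> o -> q <> o -> pdist w (sval (v p)) (sval (v q)) =
    r ^+ 2 * pdist w (sval p) (sval q) / (pdist w (sval p) (sval o) * pdist w (sval q) (sval o)).
  by move=> po qo; exact: (inv_dist iv po qo).
have q0 : 0 < fdist (sval o) w by exact: fdist_gt0.
pose k := (r ^+ 2 * fdist (sval o) w ^+ 2)^-1.
have k0 : 0 < k by rewrite invr_gt0 mulr_gt0// exprn_gt0.
have fd0 p : p <> o -> pdist (f w) (f (sval p)) (f (sval o)) = k * pdist w (sval p) (sval o).
  move=> po; rewrite fw fo fp// pdist_change_remote//; first last.
  - exact/svalN/vo.
  - exact: (svalP (v p)).
  rewrite vd0// /k; have := pos _ po => p0.
  by field; rewrite !gt_eqF.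
have fm : mobius_automorphism f.
  apply: (@similarity_mobius _ _ f w k) => //; first exact: inv_bij.
  elim/(@punctured_ind o) => [y /(_ erefl)//| |p po].
    elim/(@punctured_ind o) => [_ /(_ erefl)//| |p po] _ _.
      by rewrite !pdistxx mulr0.
    by rewrite pdistC fd0// (pdistC w).
  elim/(@punctured_ind o) => [_ /(_ erefl)//| |q qo] _ _; first exact: fd0.
  have sv s : s <> o -> sval (v s) <> w /\ sval (v s) <> sval o.
    by move=> so; split; [exact: (svalP (v s)) | exact/svalN/vo].
  have [p1 p2] := sv p po; have [q1 q2] := sv q qo.
  rewrite fw !fp// (pdist_change p1 q1 p2 q2 ow) vd// !vd0// /k.
  have := pos _ po; have := pos _ qo => p0 q0'.
  by field; rewrite !gt_eqF.
split => //.
- elim/(@punctured_ind o) => [||p po]; rewrite ?fw ?fo//; first exact: nesym.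
  by rewrite fp//; apply/svalN/(inv_neq iv).
- have sub x : psphere w (sval o) r x -> psphere w (sval o) r (f x).
    elim/(@punctured_ind o): x => [[]//|[]//|p po [_ _ pr]].
    rewrite fp//; split; [exact: (svalP (v p)) | exact/svalN/vo |].
    by rewrite vd0// pr expr2 mulfK// gt_eqF.
  apply/seteqP; split => [_ [x xS <-]|x xS]; first exact: sub.
  by exists (f x); [exact: sub | exact: fK].
- move=> B Bc Bw Bo; have [c [[cw cd] cB conto]] := circle_line Bc Bw.
  have [t0 ot0] := conto _ Bo ow.
  pose e t : punctured := exist _ (c (t0 + t)) (cw _).
  have el : isometric_line d e.
    by move=> s t; rewrite /d /= cd; congr `|_|; ring.
  have e0 : e 0 = o by apply: punctured_inj; rewrite /= addr0.
  have sub x : B x -> B (f x).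
    elim/(@punctured_ind o): x => [||p po Bp]; rewrite ?fw ?fo//.
    rewrite fp//; have [t pt] := conto _ Bp (svalP p).
    have -> : p = e (t - t0) by apply: punctured_inj; rewrite /= addrC subrK.
    by rewrite (inv_line iv el e0); exact: cB.
  apply/seteqP; split => [_ [x xS <-]|x xS]; first exact: sub.
  by exists (f x); [exact: sub | exact: fK].
Qed.

Definition punctured_inversiveSpace : inversiveSpace R.
Proof.
refine (@InversiveSpace R punctured punctured_dist _ _ _ _ _ _ _ _).
- move=> p q; split => [h|->]; last exact: pdistxx.
  by apply: punctured_inj; apply/(pdist_eq0 (svalP p) (svalP q)).
- by move=> p q; exact: pdistC.
- move=> p q s.
  exact: (pdist_triangle X_ptolemy) (punctured_neq p) (punctured_neq q) (punctured_neq s).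
- move=> p q s t; exact: (pdist_ptolemy X_ptolemy) (punctured_neq p) (punctured_neq q)
    (punctured_neq s) (punctured_neq t).
(* A sequence in the compact [X] has a limit, and boundedness keeps it away from [w], near which
   distances blow up. *)
- move=> u o B uB; have un n : sval (u n) <> w by exact: (svalP (u n)).
  have [x ux] := compact_free_ultra (fun n => sval (u n)) X_compact.
  have xw : x <> w.
    move=> xw; rewrite xw in ux.
    have /filter_ex[n] := near_pdist_oo B ux (svalP o) un.
    by rewrite ltNge pdistC => /negP; apply; exact: uB.
  by exists (exist _ x xw); exact: near_pdist ux xw un.
- have [c [[cw cd] _ _]] := circle_line A_circle Aw.
  by exists (fun t => exist _ (c t) (cw t)).
- move=> o r r0 [p pr].
  have po : sval p <> sval o.
    by move=> e; move: pr r0; rewrite /punctured_dist e pdistxx => <-; rewrite ltxx.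
  have := psphere_between (svalP o) (svalP p) po; rewrite -/(punctured_dist p o) pr.
  move=> /(X_inversions (nesym (svalP o)))[phi [phiP _]].
  by exists (inv_restrict phi o); apply: inv_restrict_inversion => //; exists p.
- move=> o r v v' r0 [p pr] iv iv' q.
  have po : sval p <> sval o.
    by move=> e; move: pr r0; rewrite /punctured_dist e pdistxx => <-; rewrite ltxx.
  have := psphere_between (svalP o) (svalP p) po; rewrite -/(punctured_dist p o) pr.
  move=> /(X_inversions (nesym (svalP o)))[phi [_ phiU]].
  have [->|qo] := pselect (q = o); first by rewrite (inv_center iv) (inv_center iv').
  apply: punctured_inj; rewrite -(inv_extend_neq v qo) -(inv_extend_neq v' qo).
  by rewrite -(phiU _ (inv_extend_inversion r0 iv)) (phiU _ (inv_extend_inversion r0 iv')).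
Defined.

Local Notation M := punctured_inversiveSpace.

Definition sim_extend (g : M -> M) (x : X) : X :=
  match pselect (x <> w) with
  | left h => sval (g (exist _ x h))
  | right _ => w
  end.

Lemma sim_extend_w g : sim_extend g w = w.
Proof. by rewrite /sim_extend; case: pselect. Qed.

Lemma sim_extendE g (p : M) : sim_extend g (sval p) = sval (g p).
Proof.
rewrite /sim_extend; case: pselect => [h|/(_ (svalP p))//].
by congr (sval (g _)); exact: punctured_inj.
Qed.

Lemma sim_extend_mobius k g h : similarity k g h ->
  mobius_automorphism (sim_extend g).
Proof.
move=> gh; have split_X (P : X -> Prop) : P w -> (forall p : M, P (sval p)) ->
    forall x, P x.
  move=> Pw Pp x; have [->//|xw] := pselect (x = w).
  exact: (Pp (exist _ x xw)).
apply: (@similarity_mobius _ _ _ w k).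
- exists (sim_extend h); elim/split_X => [|p]; rewrite ?sim_extend_w// !sim_extendE.
    by rewrite (simK gh).
  by rewrite (simVK gh).
- exact: sim_gt0 gh.
- rewrite sim_extend_w; elim/split_X => [y /(_ erefl)//|p].
  elim/split_X => [_ /(_ erefl)//|q] _ _.
  by rewrite !sim_extendE; exact: (sim_dist gh p q).
Qed.

(** On the punctured circle [f] is a similarity of some factor [k]. A homothety undoing [k] and an
    isometry restoring the base point turn the image into an isometric line through [e 0]; an
    isometry carries [e] onto it, and the first two maps are then reversed. *)
Lemma extend_fixing (f : X -> X) : mobius_on A f -> f w = w ->
  exists g, mobius_automorphism g /\ forall x, A x -> g x = f x.
Proof.
move=> fm fw; have [finj _] := fm.
have [c [[cw cd] cA conto]] := circle_line A_circle Aw.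
have [k k0 kd] := mobius_similarity fm Aw; rewrite fw in kd.
have fc t : f (c t) <> w.
  by move=> fcw; apply: (cw t); apply: finj; rewrite ?inE// fcw fw.
pose e t : M := exist _ (c t) (cw t); pose e' t : M := exist _ (f (c t)) (fc t).
have el : isometric_line (@dist R M) e by move=> s t; exact: cd.
have e'd s t : dist (e' s) (e' t) = k * `|s - t|.
  by rewrite -cd; apply: kd.
have [H [H' HH]] := homothety_ex (e 0) k0; have Hs := similarity_inv (hom_sim HH).
have [J [J' [JI J0]]] := isometry_transitive (H' (e' 0)) (e 0).
have e2l : isometric_line (@dist R M) (fun t => J (H' (e' t))).
  move=> s t; rewrite (isometry_dist _ _ JI) (sim_dist Hs) e'd mulKf//.
  by rewrite gt_eqF.
have [g [g' [gI ge]]] := isometry_lines el e2l erefl J0.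
have GI := similarity_comp (similarity_comp (hom_sim HH) (isometry_inv JI)) gI.
exists (sim_extend ((H \o J') \o g)); split; first exact: sim_extend_mobius GI.
move=> x Ax; have [->|xw] := pselect (x = w); first by rewrite sim_extend_w fw.
have [t ->] := conto x Ax xw.
suff : sim_extend ((H \o J') \o g) (sval (e t)) = f (c t) by [].
rewrite sim_extendE /= ge.
by rewrite (simK JI) (simK Hs).
Qed.

End PuncturedSpace.

Theorem proposition7p1 (R : realType) (X : mobiusSpace R)
  (X_compact : compact [set: X])
  (X_ptolemy : ptolemy_space X)
  (propE : exists A : set X, ptolemy_circle A)
  (propI : forall (w w' : X) (S : set X), w <> w' -> sphere_between w w' S ->
     exists! phi : X -> X, space_inversion w w' S phi) :
  forall A A' : set X, ptolemy_circle A -> ptolemy_circle A' ->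
  forall f : X -> X, set_fun A A' f -> mobius_on A f ->
  exists g : X -> X, mobius_automorphism g /\ (forall x, A x -> g x = f x).
Proof.
move=> A _ Ac _ f _ fm.
have [w Aw] : exists w, A w.
  have [[_ [g [_ gA _ _ _]]] _] := Ac; exists (g (0, 1)); apply: gA.
  by rewrite /unit_circle/= expr0n expr1n add0r.
have ext := extend_fixing X_compact X_ptolemy propI Ac Aw.
have [fw|fw] := pselect (f w = w); first exact: ext.
have [c [[cw cd] _ _]] := circle_line Ac Aw.
(* A third point is needed for a sphere between [w] and [f w] to exist. *)
have [x [xw xf]] : exists x, x <> w /\ x <> f w.
  have [c0|c0] := pselect (c 0 = f w); last by exists (c 0).
  exists (c 1); split => // c1; have := cd 1 0.
  by rewrite c1 c0 pdistxx subr0 normr1 => /esym/eqP; rewrite oner_eq0.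
(* [phi] exchanges [w] and [f w], so [phi \o f] fixes [w]; being an involution, [phi] also turns the
   extension of [phi \o f] back into one of [f]. *)
have [phi [[[pm phiK] _ pw _ _] _]] := propI _ _ _ (nesym fw)
  (psphere_between fw xw xf).
have [|g [gm gE]] := ext (phi \o f) (mobius_on_comp fm pm.2).
  by rewrite /= -pw phiK.
exists (phi \o g); split; first exact: mobius_automorphism_comp.
by move=> y Ay; rewrite /= gE//= phiK.
Qed.
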